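(* Let $k$ be a constructive field of characteristic zero. Novikov dependence of a finite system of elements of a free Novikov algebra over $k$ is algorithmically recognizable: there is an algorithm that, given any finite system of elements $f_1,\ldots,f_p$ of the free Novikov algebra $N\langle x_1,\ldots,x_n\rangle$ over $k$, decides whether $f_1,\ldots,f_p$ are Novikov dependent.
   Context: A (left) Novikov algebra is a nonassociative algebra $(A,\circ)$ satisfying $(a\circ b)\circ c-a\circ(b\circ c)=(b\circ a)\circ c-b\circ(a\circ c)$ and $(a\circ b)\circ c=(a\circ c)\circ b$ for all $a,b,c\in A$. A constructive (computable) field is a field whose elements are given by an effective numbering with respect to which equality is decidable and the field operations are computable. $k\{x_1,\ldots,x_n\}$ is the differential polynomial algebra over $k$ with one derivation $\delta$: the polynomial algebra over $k$ in independent variables $x_i^{(r)}$ ($1\le i\le n$, $r\ge 0$, $x_i^{(0)}=x_i$), with the $k$-linear derivation given by $\delta(x_i^{(r)})=x_i^{(r+1)}$ (zero on $k$). With the operation $f\circ g=f\,\delta(g)$ it is a Novikov algebra, and $N_0\langle x_1,\ldots,x_n\rangle$ denotes its $\circ$-subalgebra generated by $x_1,\ldots,x_n$. It is the free Novikov algebra without identity in the variables $x_1,\ldots,x_n$, and the differential monomials $x_{i_1}^{(s_1)}\cdots x_{i_t}^{(s_t)}$ with $t-(s_1+\cdots+s_t)=1$ form a basis of it over $k$. The algebra $N\langle x_1,\ldots,x_n\rangle=k\oplus N_0\langle x_1,\ldots,x_n\rangle$, obtained from $N_0\langle x_1,\ldots,x_n\rangle$ by formally adjoining an identity, is called the free Novikov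 algebra over $k$ in the variables $x_1,\ldots,x_n$ with identity. The algebra $N\langle z_1,\ldots,z_p\rangle$ is defined in the same way in variables $z_1,\ldots,z_p$. Elements $f_1,\ldots,f_p$ of $N\langle x_1,\ldots,x_n\rangle$ (in particular, elements of $N_0\langle x_1,\ldots,x_n\rangle$) are called Novikov dependent if there exists a nonzero element $h(z_1,\ldots,z_p)\in N\langle z_1,\ldots,z_p\rangle$ such that $h(f_1,\ldots,f_p)=0$, where $h(f_1,\ldots,f_p)$ is the result of substituting $f_i$ for $z_i$. *)

(* Defs.v *)
From HB Require Import structures.
From mathcomp Require Import all_boot all_order all_algebra finmap.
From mathcomp.multinomials Require Import monalg.

Set Implicit Arguments.
Unset Strict Implicit.
Unset Printing Implicit Defensive.

Import GRing.Theory.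
Local Open Scope ring_scope.

(* Total recursive functions: Kleene's class, with minimization restricted to
   regular functions, so that every member is total.  The constructors take the
   defining equations pointwise, so the class is closed under extensional
   equality by construction. *)
Inductive recursive : forall m : nat, (m.-tuple nat -> nat) -> Prop :=
| rec_zero m (h : m.-tuple nat -> nat) :
    (forall v, h v = 0%N) -> recursive h
| rec_succ (h : 1.-tuple nat -> nat) :
    (forall v, h v = (tnth v ord0).+1) -> recursive h
| rec_proj m (i : 'I_m) (h : m.-tuple nat -> nat) :
    (forall v, h v = tnth v i) -> recursive h
| rec_comp l m (f : l.-tuple nat -> nat) (g : 'I_l -> m.-tuple nat -> nat)
    (h : m.-tuple nat -> nat) :
    recursive f -> (forall i, recursive (g i)) ->
    (forall v, h v = f [tuple g i v | i < l]) -> recursive h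
| rec_prim m (f : m.-tuple nat -> nat) (g : m.+2.-tuple nat -> nat)
    (h : m.+1.-tuple nat -> nat) :
    recursive f -> recursive g ->
    (forall v : m.-tuple nat, h [tuple of 0%N :: v] = f v) ->
    (forall (i : nat) (v : m.-tuple nat),
       h [tuple of i.+1 :: v] =
       g [tuple of i :: [tuple of h [tuple of i :: v] :: v]]) ->
    recursive h
| rec_min m (f : m.+1.-tuple nat -> nat) (h : m.-tuple nat -> nat) :
    recursive f ->
    (forall v : m.-tuple nat,
       f [tuple of h v :: v] = 0%N /\
       (forall i : nat, (i < h v)%N -> f [tuple of i :: v] <> 0%N)) ->
    recursive h.

(* [nu a] is the field element with number [a]; an element may have several
   numbers. *)
Record constructive_field (k : fieldType) (nu : nat -> k) : Prop := {
  numbering_onto : forall x : k, exists a : nat, nu a = x;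
  eq_computable : exists e : 2.-tuple nat -> nat,
    recursive e /\ (forall a b : nat, e [tuple a; b] = 1%N <-> nu a = nu b);
  add_computable : exists f : 2.-tuple nat -> nat,
    recursive f /\ (forall a b : nat, nu (f [tuple a; b]) = nu a + nu b);
  opp_computable : exists f : 1.-tuple nat -> nat,
    recursive f /\ (forall a : nat, nu (f [tuple a]) = - nu a);
  mul_computable : exists f : 2.-tuple nat -> nat,
    recursive f /\ (forall a b : nat, nu (f [tuple a; b]) = nu a * nu b);
  inv_computable : exists f : 1.-tuple nat -> nat,
    recursive f /\
    (forall a : nat, nu a != 0 -> nu (f [tuple a]) = (nu a)^-1)
}.

(* The index [(i, r)] stands for the variable x_i^(r), so that [dpoly k n] is
   k{x_1,...,x_n} with derivation [delta] below. *)
Definition dmonom (n : nat) := {cmonom ('I_n * nat)%type}.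
Definition dpoly (k : fieldType) (n : nat) := {malg k[dmonom n]}.

Section DifferentialPolynomials.
Variable k : fieldType.

Definition dvar n (i : 'I_n) (r : nat) : dpoly k n :=
  << (ucm (i, r) : dmonom n) >>.

(* On a monomial m, delta m is the sum of (m_v) (m / v) v' over the variables v
   of m, where m_v is the exponent of v and v' is x_i^(r+1) for v = x_i^(r). *)
Definition delta n (g : dpoly k n) : dpoly k n :=
  \sum_(m <- msupp g) \sum_(v <- finsupp (cmonom_val m))
    (g@_m *+ m v) *:
      (<< (divcm m (ucm v) : dmonom n) >> * dvar v.1 v.2.+1 : dpoly k n).

Definition circ n (f g : dpoly k n) : dpoly k n := f * delta g.

(* The smallest subspace containing the x_i and closed under [circ]. *)
Inductive novikov0 (n : nat) : dpoly k n -> Prop :=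
| novikov0_var (i : 'I_n) : novikov0 (dvar i 0)
| novikov0_zero : novikov0 0
| novikov0_add (f g : dpoly k n) : novikov0 f -> novikov0 g -> novikov0 (f + g)
| novikov0_scale (c : k) (f : dpoly k n) : novikov0 f -> novikov0 (c *: f)
| novikov0_circ (f g : dpoly k n) :
    novikov0 f -> novikov0 g -> novikov0 (circ f g).

(* k (+) N_0, the identity being identified with the constant 1: elements of
   N_0 have zero constant term, so the sum in k{x_1,...,x_n} is direct. *)
Definition novikov n (f : dpoly k n) : Prop :=
  exists (c : k) (g : dpoly k n), novikov0 g /\ f = c%:MP + g.

(* z_i^(r) is sent to delta^r (f_i).  On N_0<z_1,...,z_p>, for f_i in
   N_0<x_1,...,x_n>, this is the Novikov algebra morphism z_i |-> f_i.  The
   unital algebra k (+) N_0 is not a Novikov algebra, since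
   (1 o b) o c <> (1 o c) o b in general; hence substitution of elements with a
   nonzero constant term is taken in k{x_1,...,x_n}. *)
Definition dsubst p n (f : 'I_p -> dpoly k n) (h : dpoly k p) : dpoly k n :=
  mmap (fun c : k => c%:MP : dpoly k n)
    (fun m : dmonom p =>
       \prod_(v <- finsupp (cmonom_val m)) iter v.2 (@delta n) (f v.1) ^+ m v)
    h.

Definition novikov_dependent p n (f : 'I_p -> dpoly k n) : Prop :=
  exists h : dpoly k p, [/\ novikov h, h != 0 & dsubst f h = 0].

(* Finite data presenting a differential polynomial: a list of terms, each a
   number of the coefficient and the list of the variables (with repetition).
   Presentations are not unique. *)
Definition presentation (n : nat) := seq (nat * seq ('I_n * nat)).

Definition denote (nu : nat -> k) n (s : presentation n) : dpoly k n :=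
  \sum_(t <- s) nu t.1 *: \prod_(v <- t.2) dvar v.1 v.2.

End DifferentialPolynomials.

(* Goedel numbers, by iterating the bijection [CodeSeq.code : seq nat -> nat]. *)
Definition code_var n (v : 'I_n * nat) : nat :=
  CodeSeq.code [:: nat_of_ord v.1; v.2].
Definition code_term n (t : nat * seq ('I_n * nat)) : nat :=
  CodeSeq.code (t.1 :: map (@code_var n) t.2).
Definition code_presentation n (s : presentation n) : nat :=
  CodeSeq.code (map (@code_term n) s).
Definition code_system n (F : seq (presentation n)) : nat :=
  CodeSeq.code (map (@code_presentation n) F).

(* Main.v *)
Require Import Defs.
From HB Require Import structures.
From mathcomp Require Import all_boot all_order all_algebra finmap.
From mathcomp.multinomials Require Import monalg.
From mathcomp Require Import ring zify.
From Stdlib Require Import Classical_Prop.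

Set Implicit Arguments.
Unset Strict Implicit.
Unset Printing Implicit Defensive.

Import GRing.Theory.
Local Open Scope ring_scope.

(** Call f_1, ..., f_p dependent when h(f_1, ..., f_p) = 0 for some nonzero
    differential polynomial h in k{z_1, ..., z_p}.  The procedure rests on three
    facts.

    Novikov dependence is dependence, for every finite system in k{x}
    ([novikov_dependentP]).  Give x_i^(r) the weight 1 - r.  The monomials of
    weight 1 lie in N_0 ([novikov0_var_prod]), so it suffices to turn a relation
    into a relation all of whose monomials have weight 1.  The relations form an
    ideal closed under the derivation.  If h is a relation with homogeneous
    components a, b, ..., then a h' - a' h is a relation in which a has
    disappeared, while a component b has become a b' - a' b.  This is not zero:
    otherwise b / a would be a constant, hence killed by every partial derivative,
    since commuting with the derivation lowers the order of a partial derivative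
    by one; then the Euler operator would kill b / a as well, and a and b would
    have the same weight ([ddelta_proportional_weight]).  One homogeneous
    component is therefore left after finitely many steps, and multiplying it by a
    monomial of the complementary weight gives weight 1
    ([homogeneous_relation], [homogeneous_multiplier]).

    Both dependence and independence have finite certificates.  A relation
    certifies dependence.  Independence of f_1, ..., f_p in k{x_1, ..., x_n} is
    certified by elements f_(p+1), ..., f_q with q <= n and, for each j, a
    differential polynomial p_j with p_j(f_1, ..., f_q, x_j) = 0 and some partial
    derivative of p_j in a derivative of the last variable that does not vanish
    there; in other words every x_j is differentially algebraic over the f's.
    Such data exist: adjoin variables x_j to the system while it stays
    independent; this stops within n elements, because more than n elements are
    dependent by a count of monomials ([algebraic_counting_malg],
    [too_many_dependent]), and then the minimal relations are the p_j
    ([certificate_exists]).  Conversely, assume that the f's also satisfied a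
    relation h, of minimal degree.  At a point where the separants of h and of all
    p_j do not vanish, the differentials of the derivatives of one f are
    combinations of finitely many of them and of those of the other q - 1
    elements, and the differentials of all x_j^(r) are combinations of finitely
    many and of those of the f's.  Up to order N this spans a space of dimension at
    most (n - 1) N + O(1), whereas the x_j^(r) have n (N + 1) independent
    differentials ([certificate_sound]).

    Certificates can be checked and searched for.  Addition, multiplication,
    derivation and substitution act on presentations as list programs, and a
    presentation denotes 0 if and only if, for each of its terms, the coefficients
    of the terms with the same monomial add up to 0 ([pzeroP]).  These programs are
    recursive on codes, every number decodes to an input and to a candidate
    certificate, and every input has a certificate of one kind or the other; so an
    unbounded search for a certificate is total ([computable_search]), and the kind
    of the certificate found is the answer. *)

(** * Polynomial algebras and derivations *)

Section Generation.
Variables (k : fieldType) (I : Type) (P : comNzRingType) (C : k -> P) (X : I -> P).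

Inductive gen (V : I -> Prop) : P -> Prop :=
| gen_const a : gen V (C a)
| gen_var v : V v -> gen V (X v)
| gen_add f g : gen V f -> gen V g -> gen V (f + g)
| gen_mul f g : gen V f -> gen V g -> gen V (f * g).

Lemma genS (V W : I -> Prop) f : (forall v, V v -> W v) -> gen V f -> gen W f.
Proof.
move=> VW; elim=> [a|v /VW|g h _ Wg _ Wh|g h _ Wg _ Wh].
- exact: gen_const.
- exact: gen_var.
- exact: gen_add.
- exact: gen_mul.
Qed.

(** The map [F] is the identity for derivations of the algebra itself, an
    evaluation for tangent vectors, and a substitution for the differential of
    a composite. *)
Record derivation (A : comNzRingType) (F D : P -> A) : Prop := {
  derivationD : forall f g, D (f + g) = D f + D g;
  derivationM : forall f g, D (f * g) = F f * D g + D f * F g;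
  derivationC : forall a, D (C a) = 0 }.
End Generation.

(** What the argument uses of a polynomial algebra over [k]: evaluation, the
    derivation with prescribed values on the variables, the finiteness of the
    set of variables of a polynomial, and the two properties that partial
    derivatives lower the degree and, in characteristic zero, detect the
    variables. Only the count of monomials and the decomposition into
    homogeneous components go back to the monomials. *)
Record polyAlg (k : fieldType) (I : choiceType) := PolyAlg {
  pring :> comNzRingType;
  pC : {rmorphism k -> pring};
  pX : I -> pring;
  peval : forall A : comNzRingType,
    {rmorphism k -> A} -> (I -> A) -> {rmorphism pring -> A};
  pevalC : forall (A : comNzRingType) (c : {rmorphism k -> A}) x a,
    peval c x (pC a) = c a;
  pevalX : forall (A : comNzRingType) (c : {rmorphism k -> A}) x v,
    peval c x (pX v) = x v;
  pder : (I -> pring) -> pring -> pring;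
  pder_derivation : forall u, derivation pC (fun f => f) (pder u);
  pderX : forall u v, pder u (pX v) = u v;
  pgen_finite : forall f, exists s : seq I, gen pC pX (fun v => v \in s) f;
  pdeg : pring -> nat;
  pdeg_der : forall v f, f != 0 ->
    (pdeg (pder (fun w => (w == v)%:R) f) < pdeg f)%N;
  pgen_der : forall (W : I -> Prop) f,
    (forall v, W v -> pder (fun w => (w == v)%:R) f = 0) ->
    gen pC pX (fun v => ~ W v) f }.

Arguments pX {k I p} v.

Section PolyAlgTheory.
Variables (k : fieldType) (I : choiceType) (P : polyAlg k I).
Implicit Types (f g h : P) (v w : I) (V W : I -> Prop).

Notation gen := (gen (pC P) (@pX k I P)).
Notation derivation := (derivation (pC P)).
Definition pdiff v : P -> P := pder (fun w => (w == v)%:R).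

Lemma pdiff_derivation v : derivation (fun f => f) (pdiff v).
Proof. exact: pder_derivation. Qed.

Lemma pdiffX v w : pdiff v (pX w) = (w == v)%:R.
Proof. exact: pderX. Qed.

Lemma gen_all f : gen (fun=> True) f.
Proof. by have [s] := pgen_finite f; apply: genS. Qed.

Lemma gen0 V f : (forall v, ~ V v) -> gen V f -> exists a, f = pC P a.
Proof.
move=> V0; elim=> [a|v /V0 //|g h _ [a ->] _ [b ->]|g h _ [a ->] _ [b ->]].
- by exists a.
- by exists (a + b); rewrite rmorphD.
- by exists (a * b); rewrite rmorphM.
Qed.

Section Morphisms.
Variables (A : comNzRingType).

(** The restriction to a set [V] of generators is what lets a variable be
    eliminated from a polynomial that does not involve it. *)
Lemma rmorph_ext V (F G : {rmorphism P -> A}) f :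
  (forall a, F (pC P a) = G (pC P a)) -> (forall v, V v -> F (pX v) = G (pX v)) ->
  gen V f -> F f = G f.
Proof.
move=> FGC FGX; elim=> [a|v /FGX|g h _ Eg _ Eh|g h _ Eg _ Eh] //.
- by rewrite !rmorphD Eg Eh.
- by rewrite !rmorphM Eg Eh.
Qed.

Lemma derivation0 (F D : P -> A) : derivation F D -> D 0 = 0.
Proof. by case=> _ _ DC; rewrite -(rmorph0 (pC P)) DC. Qed.

Lemma derivationN (F D : P -> A) f : derivation F D -> D (- f) = - D f.
Proof.
move=> dD; apply/eqP; rewrite -subr_eq0 opprK -(derivationD dD) addNr.
by rewrite (derivation0 dD).
Qed.

Lemma derivationB (F D : P -> A) f g : derivation F D -> D (f - g) = D f - D g.
Proof. by move=> dD; rewrite (derivationD dD) (derivationN _ dD). Qed.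

Lemma derivation_ext V (F D E : P -> A) f :
  derivation F D -> derivation F E ->
  (forall v, V v -> D (pX v) = E (pX v)) -> gen V f -> D f = E f.
Proof.
move=> dD dE DEX; elim=> [a|v /DEX//|g h _ Eg _ Eh|g h _ Eg _ Eh].
- by rewrite (derivationC dD) (derivationC dE).
- by rewrite (derivationD dD) (derivationD dE) Eg Eh.
- by rewrite (derivationM dD) (derivationM dE) Eg Eh.
Qed.

Lemma derivation_morph (B : comNzRingType) (G : {rmorphism A -> B}) (F D : P -> A) :
  derivation F D -> derivation (fun f => G (F f)) (fun f => G (D f)).
Proof.
case=> DD DM DC; split=> [f g|f g|a]; first by rewrite DD rmorphD.
  by rewrite DM rmorphD !rmorphM.
by rewrite DC rmorph0.
Qed.

Lemma derivation_sum (J : Type) (s : seq J) (c : J -> A) (F : P -> A) (D : J -> P -> A) :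
  (forall j, derivation F (D j)) -> derivation F (fun f => \sum_(j <- s) D j f * c j).
Proof.
move=> dD; split=> [f g|f g|a].
- rewrite -big_split; apply: eq_bigr => j _; case: (dD j) => DD _ _.
  by rewrite DD mulrDl.
- rewrite mulr_sumr mulr_suml -big_split; apply: eq_bigr => j _.
  by case: (dD j) => _ DM _; rewrite DM mulrDl /= mulrA; congr (_ + _); rewrite mulrAC.
- by rewrite big1 // => j _; case: (dD j) => _ _ DC; rewrite DC mul0r.
Qed.

End Morphisms.

Lemma chain_rule (A : comNzRingType) (F : {rmorphism P -> A}) (D : P -> A) (s : seq I) f :
  derivation F D -> uniq s -> gen (fun v => v \in s) f ->
  D f = \sum_(v <- s) F (pdiff v f) * D (pX v).
Proof.
move=> dD us.
have dE : derivation F (fun f => \sum_(v <- s) F (pdiff v f) * D (pX v)).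
  apply: (@derivation_sum _ _ s (fun v => D (pX v)) F (fun v f => F (pdiff v f))).
  by move=> v; have := derivation_morph F (pdiff_derivation v).
apply: derivation_ext dD dE _ => w w_s.
rewrite (bigD1_seq w) //= pdiffX eqxx rmorph1 mul1r big1 ?addr0 //.
by move=> v; rewrite eq_sym pdiffX => /negbTE ->; rewrite rmorph0 mul0r.
Qed.

(** If all terms of the chain rule but one vanish and the total is zero, then
    so is the remaining term.  Applied to the derivatives of a relation, this
    expresses the differential of one element through the others. *)
Lemma chain_rule_isolate (A : comNzRingType) (F : {rmorphism P -> A}) (D : P -> A) v f :
  derivation F D -> D f = 0 ->
  (forall w, w != v -> F (pdiff w f) * D (pX w) = 0) -> F (pdiff v f) * D (pX v) = 0.
Proof.
move=> dD Df0 rest; have [s sf] := pgen_finite f.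
have sf' : gen (fun w => w \in undup (v :: s)) f.
  by apply: genS sf => w w_s; rewrite mem_undup in_cons w_s orbT.
have := chain_rule dD (undup_uniq _) sf'.
rewrite Df0 (bigD1_seq v) ?undup_uniq ?mem_undup ?mem_head //= big1 ?addr0 //.
Qed.

(** The source of all commutation rules below: a bracket of derivations is
    determined by its values on the variables. *)
Lemma derivation_bracket (D E : P -> P) :
  derivation (fun f => f) D -> derivation (fun f => f) E ->
  derivation (fun f => f) (fun f => D (E f) - E (D f)).
Proof.
move=> dD dE; split=> [f g|f g|a].
- by rewrite !(derivationD dD, derivationD dE) opprD addrACA.
- rewrite !(derivationM dD, derivationM dE, derivationD dD, derivationD dE).
  ring.
- rewrite (derivationC dD) (derivationC dE) (derivation0 dD) (derivation0 dE).
  by rewrite subr0.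
Qed.
End PolyAlgTheory.

(** * Points and the absence of zero divisors *)

Section Points.
Variables (k : fieldType) (char0 : [pchar k] =i pred0).

(** The field is infinite, as it contains the natural numbers. *)
Lemma poly_eq0_all (p : {poly k}) : (forall t, p.[t] = 0) -> p = 0.
Proof.
move=> p0; apply/eqP/negPn/negP => pN0.
have := max_poly_roots pN0 (rs := [seq n%:R | n <- iota 0 (size p)]).
rewrite size_map size_iota ltnn => noroots.
suff : false by []; apply: noroots.
  by apply/allP => _ /mapP [n _ ->]; rewrite /root p0.
rewrite map_inj_in_uniq ?iota_uniq // => m n _ _ /eqP.
wlog le_mn : m n / (m <= n)%N => [IH|].
  by case: (leqP m n) => [|/ltnW] le Emn; [|symmetry]; apply: IH; rewrite // eq_sym.
rewrite -(subnKC le_mn) natrD -subr_eq0 opprD addrA subrr sub0r oppr_eq0.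
have /charf0P -> := char0.
by move=> /eqP ->; rewrite addn0.
Qed.

Variables (I : choiceType) (P : polyAlg k I).
Implicit Types (f g h : P) (v w : I).

Definition point_eval (a : I -> k) : {rmorphism P -> k} := peval P idfun a.

Lemma point_evalC a c : point_eval a (pC P c) = c.
Proof. by rewrite /point_eval pevalC. Qed.

Lemma point_evalX a v : point_eval a (pX v) = a v.
Proof. by rewrite /point_eval pevalX. Qed.

(** The restriction of polynomials to the affine line through [a] in direction
    [b], with parameter 'X. *)
Definition line (a b : I -> k) : {rmorphism P -> {poly k}} :=
  peval P (@polyC k) (fun v => (a v)%:P + (b v)%:P * 'X).

Lemma horner_line a b t f : (line a b f).[t] = point_eval (fun v => a v + b v * t) f.
Proof.
have -> : (line a b f).[t] = (horner_eval t \o line a b) f by [].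
apply: (rmorph_ext _ _ (gen_all f)) => [c|v _] /=.
  by rewrite point_evalC /line pevalC /horner_eval hornerC.
by rewrite point_evalX /line pevalX /horner_eval !hornerE.
Qed.

Lemma point_eval_ext a b f : a =1 b -> point_eval a f = point_eval b f.
Proof.
move=> ab; apply: (rmorph_ext _ _ (gen_all f)) => [c|v _]; rewrite ?point_evalC //.
by rewrite !point_evalX ab.
Qed.

Lemma deriv_line a v f :
  (line a (fun w => (w == v)%:R) f)^`() = line a (fun w => (w == v)%:R) (pdiff v f).
Proof.
set L := line _ _.
have dL : derivation (pC P) L (fun f => (L f)^`()).
  split=> [g h|g h|c]; rewrite ?rmorphD ?rmorphM ?derivD ?derivM //.
    by rewrite addrC.
  by rewrite /L /line pevalC derivC.
have dE : derivation (pC P) L (fun f => L (pdiff v f)).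
  by have := derivation_morph L (pdiff_derivation P v).
apply: (derivation_ext dL dE _ (gen_all f)) => w _.
rewrite pdiffX rmorph_nat /L /line pevalX derivD derivM !derivC derivX.
by rewrite add0r mul0r add0r mulr1 polyC_natr.
Qed.

(** If a nonzero polynomial of least degree vanished at all points, then so
    would its restrictions to coordinate lines and hence its partial
    derivatives; these have smaller degree, so they are zero and the polynomial
    is a nonzero constant. *)
Lemma exists_nonzero_point f : f != 0 -> exists a, point_eval a f != 0.
Proof.
move: {-1}(pdeg f) (leqnn (pdeg f)) => d; elim: d f => [|d IHd] f le_fd f0.
  case: (classic (exists v : I, True)) => [[v _]|noI].
    by have := pdeg_der v f0; rewrite ltnNge (leq_trans le_fd).
  have [c Ec] := gen0 (fun v _ => noI (ex_intro _ v Logic.I)) (gen_all f).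
  exists (fun=> 0); rewrite Ec point_evalC; apply: contra_neq f0 => c0.
  by rewrite Ec c0 rmorph0.
apply: NNPP => noa.
have f_ev a : point_eval a f = 0.
  by apply/eqP/negPn/negP => fa; apply: noa; exists a.
have pd0 v : pdiff v f = 0.
  apply/eqP/negPn/negP => pdN0.
  have [|a /negP []] := IHd _ _ pdN0.
    by rewrite -ltnS (leq_trans (pdeg_der v f0)).
  have L0 : line a (fun w => (w == v)%:R) f = 0.
    by apply: poly_eq0_all => t; rewrite horner_line f_ev.
  have := deriv_line a v f; rewrite L0 deriv0 => /esym/(congr1 (horner^~ 0)).
  rewrite horner_line horner0 => E; apply/eqP; rewrite -[RHS]E.
  by apply: point_eval_ext => w; rewrite mulr0 addr0.
have [//|c Ec] := gen0 _ (pgen_der (W := fun=> True) (fun v _ => pd0 v)).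
  by move=> v; apply.
move: (f_ev (fun=> 0)); rewrite Ec point_evalC => c0.
by move: f0; rewrite Ec c0 rmorph0 eqxx.
Qed.

(** On a line through a point where [f] does not vanish and a point where [g]
    does not vanish, both restrict to nonzero polynomials in one variable. *)
Lemma pmulf_neq0 f g : f != 0 -> g != 0 -> f * g != 0.
Proof.
move=> /exists_nonzero_point [a fa] /exists_nonzero_point [b gb].
pose L := line a (fun v => b v - a v).
have La h : (L h).[0] = point_eval a h.
  by rewrite horner_line; apply: point_eval_ext => v; rewrite mulr0 addr0.
have Lb h : (L h).[1] = point_eval b h.
  by rewrite horner_line; apply: point_eval_ext => v; rewrite mulr1 addrC subrK.
have Lf : L f != 0 by apply: contraNneq fa => E; rewrite -La E horner0.
have Lg : L g != 0 by apply: contraNneq gb => E; rewrite -Lb E horner0.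
have := mulf_neq0 Lf Lg; rewrite -rmorphM.
by apply: contraNneq => ->; rewrite rmorph0.
Qed.

Lemma pmulf_eq0 f g : f * g = 0 -> f = 0 \/ g = 0.
Proof.
move=> fg0; case: (eqVneq f 0) => [|f0]; first by left.
case: (eqVneq g 0) => [|g0]; first by right.
by have := pmulf_neq0 f0 g0; rewrite fg0 eqxx.
Qed.

Lemma pmulfI f g h : f != 0 -> f * g = f * h -> g = h.
Proof.
move=> f0 E; apply/eqP; rewrite -subr_eq0; apply/eqP.
have : f * (g - h) = 0 by rewrite mulrBr E subrr.
by case/pmulf_eq0 => // E0; rewrite E0 eqxx in f0.
Qed.

Lemma pprod_neq0 (J : eqType) (s : seq J) (F : J -> P) :
  (forall j, j \in s -> F j != 0) -> \prod_(j <- s) F j != 0.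
Proof.
elim: s => [|j s IHs] Fs; first by rewrite big_nil oner_neq0.
rewrite big_cons; apply: pmulf_neq0; first by apply: Fs; rewrite mem_head.
by apply: IHs => i i_s; apply: Fs; rewrite in_cons i_s orbT.
Qed.
End Points.

(** * Differential substitution *)

Lemma nonzero_solution (k : fieldType) (U : finType) (q : nat)
    (E : U -> 'I_q -> k) : (q < #|U|)%N ->
  exists2 x : U -> k, (exists u, x u != 0) & forall j, \sum_u x u * E u j = 0.
Proof.
move=> lt_q; pose M := \matrix_(i < #|U|, j < q) E (enum_val i) j.
have : kermx M != 0.
  rewrite kermx_eq0 /row_free neq_ltn; apply/orP; left.
  by rewrite (leq_ltn_trans _ lt_q) // rank_leq_col.
case/rowV0Pn => y /sub_kermxP yM /rV0Pn [i yi].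
exists (fun u => y 0 (enum_rank u)); first by exists (enum_val i); rewrite enum_valK.
move=> j; move/rowP: yM => /(_ j); rewrite !mxE; apply: etrans.
rewrite (reindex (@enum_val U U)) /=; last exact/onW_bij/enum_val_bij.
by apply: eq_bigr => l _; rewrite mxE enum_valK.
Qed.

Section Differential.
Variables (k : fieldType) (char0 : [pchar k] =i pred0).

Lemma pdiff_gen0 (I : choiceType) (P : polyAlg k I) (V : I -> Prop) v (f : P) :
  gen (pC P) pX V f -> ~ V v -> pdiff v f = 0.
Proof.
move=> Vf Vv; have dv := pdiff_derivation P v; elim: Vf => [a|w Vw|g h _ Eg _ Eh|g h _ Eg _ Eh].
- exact: derivationC dv a.
- by rewrite pdiffX; case: eqP => // Ewv; rewrite Ewv in Vw.
- by rewrite (derivationD dv) Eg Eh addr0.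
- by rewrite (derivationM dv) Eg Eh mulr0 mul0r addr0.
Qed.

Variable P : forall n : nat, polyAlg k ('I_n * nat)%type.

Definition ddelta n : P n -> P n := pder (fun v : 'I_n * nat => pX (v.1, v.2.+1)).

Lemma ddelta_derivation n : derivation (pC (P n)) (fun f => f) (@ddelta n).
Proof. exact: pder_derivation. Qed.

Lemma ddeltaX n (v : 'I_n * nat) : ddelta (pX v : P n) = pX (v.1, v.2.+1).
Proof. exact: pderX. Qed.

Lemma iter_ddeltaX n (i : 'I_n) s r :
  iter s (@ddelta n) (pX (i, r)) = pX (i, (r + s)%N).
Proof. by elim: s => [|s /= ->]; rewrite ?addn0 // ddeltaX addnS. Qed.

Lemma ddelta_nat n m : ddelta (m%:R : P n) = 0.
Proof. by rewrite -(rmorph_nat (pC (P n))) (derivationC (@ddelta_derivation n)). Qed.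

Lemma ddelta0 n : ddelta (0 : P n) = 0.
Proof. exact: ddelta_nat 0%N. Qed.

Lemma iter_ddelta0 n t : iter t (@ddelta n) 0 = 0.
Proof. by elim: t => //= t ->; exact: ddelta0. Qed.

Lemma pdiff_ddeltaS n (i : 'I_n) r (f : P n) :
  pdiff (i, r.+1) (ddelta f) = ddelta (pdiff (i, r.+1) f) + pdiff (i, r) f.
Proof.
apply/eqP; rewrite addrC -subr_eq; apply/eqP.
have dB := derivation_bracket (pdiff_derivation (P n) (i, r.+1)) (@ddelta_derivation n).
apply: (derivation_ext dB (pdiff_derivation (P n) (i, r)) _ (gen_all f)) => w _.
by rewrite ddeltaX !pdiffX ddelta_nat subr0 xpair_eqE eqSS; case: w.
Qed.

Section Substitution.
Variables (q n : nat) (G : 'I_q -> P n).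

Definition dsub : {rmorphism P q -> P n} :=
  peval (P q) (pC (P n)) (fun v => iter v.2 (@ddelta n) (G v.1)).

Lemma dsubC a : dsub (pC (P q) a) = pC (P n) a.
Proof. exact: pevalC. Qed.

Lemma dsubX v : dsub (pX v) = iter v.2 (@ddelta n) (G v.1).
Proof. exact: pevalX. Qed.

Lemma dsub_ddelta h : dsub (ddelta h) = ddelta (dsub h).
Proof.
have dd := @ddelta_derivation n.
have d1 : derivation (pC (P q)) dsub (fun h => ddelta (dsub h)).
  split=> [f g|f g|a]; rewrite ?rmorphD ?rmorphM ?dsubC.
  - exact: derivationD dd _ _.
  - exact: derivationM dd _ _.
  - exact: derivationC dd _.
have d2 : derivation (pC (P q)) dsub (fun h => dsub (ddelta h)).
  by have := derivation_morph dsub (@ddelta_derivation q).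
apply: (derivation_ext d2 d1 _ (gen_all h)) => v _.
by rewrite ddeltaX !dsubX.
Qed.

Lemma dsub_iter t h : dsub (iter t (@ddelta q) h) = iter t (@ddelta n) (dsub h).
Proof. by elim: t => //= t IHt; rewrite dsub_ddelta IHt. Qed.

(** The separants of [h] and of its derivatives agree: if, after substitution,
    [e] is the order of [h] in z_i, then [e + t] is that of the [t]-th
    derivative, with the same leading partial derivative. *)
Lemma pdiff_iter_ddelta (i : 'I_q) e t h :
  (forall r, (e < r)%N -> dsub (pdiff (i, r) h) = 0) ->
  dsub (pdiff (i, (e + t)%N) (iter t (@ddelta q) h)) = dsub (pdiff (i, e) h) /\
  forall r, (e + t < r)%N -> dsub (pdiff (i, r) (iter t (@ddelta q) h)) = 0.
Proof.
move=> h0; elim: t => [|t [IH1 IH2]]; first by rewrite addn0.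
have step r : (e + t <= r)%N -> dsub (pdiff (i, r.+1) (iter t.+1 (@ddelta q) h)) =
    dsub (pdiff (i, r) (iter t (@ddelta q) h)).
  move=> le_r; rewrite iterS pdiff_ddeltaS rmorphD dsub_ddelta IH2 ?ltnS //.
  by rewrite ddelta0 add0r.
split=> [|r]; first by rewrite addnS step.
by rewrite addnS; case: r => // r lt_r; rewrite step ?IH2 // ltnW.
Qed.

Definition dependent : Prop := exists2 h : P q, h != 0 & dsub h = 0.

(** A relation of least degree: partial derivatives lower the degree. *)
Lemma minimal_relation : dependent ->
  exists h : P q, [/\ h != 0, dsub h = 0 &
    forall v, pdiff v h != 0 -> dsub (pdiff v h) != 0].
Proof.
case=> h; move: {-1}(pdeg h) (leqnn (pdeg h)) => d.
elim: d h => [|d IHd] h le_hd h0 Rh.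
  exists h; split=> // v; have := pdeg_der v h0.
  by rewrite ltnNge (leq_trans le_hd).
case: (classic (exists2 v, pdiff v h != 0 & dsub (pdiff v h) = 0)) => [[v v0 Rv]|no].
  apply: (IHd _ _ v0 Rv); rewrite -ltnS.
  by rewrite (leq_trans (pdeg_der v h0)).
by exists h; split=> // v v0; apply/eqP => Rv; apply: no; exists v.
Qed.
End Substitution.

Lemma pdiff_order n (f : P n) : exists b, forall i r, (b < r)%N -> pdiff (i, r) f = 0.
Proof.
have [s sf] := pgen_finite f; exists (\max_(v <- s) v.2)%N => i r lt_br.
apply: (pdiff_gen0 sf) => v_s.
by move: lt_br; rewrite ltnNge (leq_bigmax_seq _ v_s).
Qed.

(** There are more components, those in the variables of order at most [N],
    than conditions. *)
Lemma exists_tangent n N (a : 'I_n * nat -> k) (L : seq (P n)) :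
  (size L < n * N.+1)%N ->
  exists2 D : 'I_n * 'I_N.+1 -> k, (exists u, D u != 0) &
    forall g, g \in L -> \sum_u point_eval (P n) a (pdiff (u.1, val u.2) g) * D u = 0.
Proof.
move=> ltL; have [|D D0 DL] := @nonzero_solution k ('I_n * 'I_N.+1)%type (size L)
  (fun u j => point_eval (P n) a (pdiff (u.1, val u.2) L`_j)).
  by rewrite card_prod !card_ord.
exists D => // g gL; have [j ltj <-] := nthP 0 gL.
by apply: etrans (DL (Ordinal ltj)); apply: eq_bigr => u _; rewrite mulrC.
Qed.

Definition extend q n (G : 'I_q -> P n) (x : P n) (i : 'I_q.+1) : P n :=
  if unlift ord_max i is Some j then G j else x.

Lemma extend_max q n (G : 'I_q -> P n) x : extend G x ord_max = x.
Proof. by rewrite /extend unlift_none. Qed.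

Lemma extend_lift q n (G : 'I_q -> P n) x i : extend G x (lift ord_max i) = G i.
Proof. by rewrite /extend liftK. Qed.

End Differential.

(** * Certificates of independence are sound *)

(** The number of conditions imposed in [certificate_sound] is smaller than the
    number of variables of order at most [N]. *)
Lemma tangent_count (q n b e S N : nat) :
  (0 < q <= n)%N -> N = (n * b + e + S)%N ->
  (q.-1 * (N + b).+1 + (e + S) < n * N.+1)%N.
Proof.
case: q => // q; case: n => // n /andP [_]; rewrite ltnS => le_qn ->.
rewrite -[q.+1.-1]/q.
set M := (_ + S)%N.
apply: leq_ltn_trans (_ : (n * (M + b).+1 + (e + S) < _)%N).
  by rewrite leq_add2r leq_mul2r le_qn orbT.
by rewrite -(addSn M b) mulnDr [X in (_ < X)%N]mulSn /M mulSn; lia.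
Qed.

Section Certificate.
Variables (k : fieldType) (char0 : [pchar k] =i pred0).
Variable P : forall n : nat, polyAlg k ('I_n * nat)%type.

(** A relation is not constant, so some variable of highest order occurs in it
    with a nonzero partial derivative. *)
Lemma relation_leading q n (G : 'I_q -> P n) (h : P q) :
  h != 0 -> dsub G h = 0 ->
  exists i e, pdiff (i, e) h != 0 /\ forall l r, (e < r)%N -> pdiff (l, r) h = 0.
Proof.
move=> h0 Rh; have [b hb] := pdiff_order h.
have exE : exists e, [exists i, pdiff (i, e) h != 0].
  apply: NNPP => noe; have pd0 v : pdiff v h = 0.
    apply/eqP/negPn/negP => v0; apply: noe; exists v.2; apply/existsP.
    by exists v.1; case: v v0.
  have [//|c Ec] := gen0 _ (pgen_der (W := fun=> True) (fun v _ => pd0 v)).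
    by move=> v; apply.
  move: Rh; rewrite Ec dsubC => /eqP; rewrite fmorph_eq0 => /eqP c0.
  by move: h0; rewrite Ec c0 rmorph0 eqxx.
have leb e : [exists i, pdiff (i, e) h != 0] -> (e <= b)%N.
  case/existsP => i; apply: contraNT; rewrite -ltnNge => /hb ->.
  exact: eqxx.
case: (ex_maxnP exE leb) => e /existsP [i ie] maxe; exists i, e; split=> // l r.
rewrite ltnNge => /negP ler; apply/eqP/negPn/negP => lr; apply/ler/maxe.
by apply/existsP; exists l.
Qed.

Lemma separant_leading q n (G : 'I_q -> P n) (h : P q) i r0 :
  dsub G (pdiff (i, r0) h) != 0 ->
  exists e, dsub G (pdiff (i, e) h) != 0 /\
    forall r, (e < r)%N -> dsub G (pdiff (i, r) h) = 0.
Proof.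
move=> h0; have [b hb] := pdiff_order h.
have leb e : dsub G (pdiff (i, e) h) != 0 -> (e <= b)%N.
  by apply: contraNT; rewrite -ltnNge => /hb ->; rewrite rmorph0.
case: (ex_maxnP (ex_intro _ r0 h0) leb) => e e0 maxe; exists e; split=> // r.
by rewrite ltnNge => /negP ler; apply/eqP/negPn/negP => /maxe.
Qed.

(** The dimension count: a relation [h] among the elements of [G] and the
    equations [p j] for the variables cannot coexist when there are at most [n]
    elements.  It is carried out dually, by a tangent vector that kills too
    much. *)
Theorem certificate_sound q n (G : 'I_q -> P n) (p : 'I_n -> P q.+1) (r : 'I_n -> nat) :
  (q <= n)%N ->
  (forall j, dsub (extend G (pX (j, 0%N))) (p j) = 0) ->
  (forall j, dsub (extend G (pX (j, 0%N))) (pdiff (ord_max, r j) (p j)) != 0) ->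
  ~ dependent G.
Proof.
move=> le_qn Rp sep /minimal_relation [h [h0 Rh minh]].
have [i0 [e0 [/minh hs h_ord]]] := relation_leading h0 Rh.
pose T j := dsub (extend G (pX (j, 0%N))).
have [b hb] : exists b, forall j i r, (b < r)%N -> pdiff (i, r) (p j) = 0.
  have [b hb] := fin_all_exists (fun j => pdiff_order (p j)).
  exists (\max_j b j)%N => j i s lt_bs; apply: hb; apply: leq_ltn_trans lt_bs.
  exact: leq_bigmax.
have [e eP] := fin_all_exists (fun j => separant_leading (sep j)).
have [a] := exists_nonzero_point char0 (pmulf_neq0 char0 hs
  (pprod_neq0 char0 (s := enum 'I_n) (F := fun j => T j (pdiff (ord_max, e j) (p j)))
    (fun j _ => (eP j).1))).
rewrite rmorphM mulf_eq0 negb_or => /andP [as0].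
rewrite rmorph_prod => aT.
have {aT} aT j : point_eval (P n) a (T j (pdiff (ord_max, e j) (p j))) != 0.
  apply: contraNneq aT => E; rewrite (bigD1_seq j) ?enum_uniq ?mem_enum //=.
  by rewrite E mul0r.
(* [b] bounds the orders of the equations [p j], [e0] and [e j] are the orders up
   to which the vanishing is imposed directly; with this [N], [tangent_count]
   applies. *)
pose N := (n * b + e0 + \sum_(j < n) e j)%N.
pose L := [seq iter t (@ddelta k P n) (G l) | l <- enum (predC1 i0), t <- iota 0 (N + b).+1]
  ++ [seq iter t (@ddelta k P n) (G i0) | t <- iota 0 e0]
  ++ flatten [seq [seq pX (j, t) | t <- iota 0 (e j)] | j <- enum 'I_n].
have sizeL : (size L < n * N.+1)%N.
  rewrite !size_cat size_allpairs size_map !size_iota -cardE cardC1 card_ord.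
  have -> : size (flatten [seq [seq pX (j, t) : P n | t <- iota 0 (e j)] | j <- enum 'I_n])
      = (\sum_(j < n) e j)%N.
    rewrite size_flatten /shape -map_comp sumnE big_map big_enum /=.
    by apply: eq_bigr => j _; rewrite size_map size_iota.
  set S := (\sum_(j < n) e j)%N.
  by apply: tangent_count => //; rewrite le_qn (leq_ltn_trans _ (ltn_ord i0)).
(* A tangent vector that kills all derivatives of [G l] up to order [N + b] for
   l different from [i0], and the low derivatives of [G i0] and of the x_j. *)
have [D [u Du] DL] := exists_tangent a sizeL.
pose Dt g := \sum_u point_eval (P n) a (pdiff (u.1, val u.2) g) * D u.
have dDt : derivation (pC (P n)) (point_eval (P n) a) Dt.
  apply: (@derivation_sum _ _ (P n) _ _ _ D (point_eval (P n) a)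
    (fun u g => point_eval (P n) a (pdiff (u.1, val u.2) g))).
  move=> w; have dw := pdiff_derivation (P n) (w.1, val w.2).
  by have := derivation_morph (point_eval (P n) a) dw.
have dDs q' (G' : 'I_q' -> P n) :
    derivation (pC (P q')) (point_eval (P n) a \o dsub G') (fun f => Dt (dsub G' f)).
  split=> [f g|f g|c] /=; rewrite ?rmorphD ?rmorphM ?dsubC.
  - exact: derivationD dDt _ _.
  - exact: derivationM dDt _ _.
  - exact: derivationC dDt _.
have Dt0 : Dt 0 = 0 by exact: derivation0 dDt.
have DtG l t : l != i0 -> (t <= N + b)%N -> Dt (iter t (@ddelta k P n) (G l)) = 0.
  move=> l_i0 le_t; apply: DL; rewrite !mem_cat; apply/orP; left.
  by apply: allpairs_f; rewrite ?mem_enum ?mem_iota.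
(* The relation [h], differentiated, makes it kill the higher derivatives of
   [G i0]. *)
have DtG0 t : (t <= N + b)%N -> Dt (iter t (@ddelta k P n) (G i0)) = 0.
  elim/ltn_ind: t => t IHt le_t; case: (ltnP t e0) => [lt_t|le_e0t].
    apply: DL; rewrite !mem_cat; apply/orP; right; apply/orP; left.
    by apply: map_f; rewrite mem_iota.
  pose s := (t - e0)%N; have Et : t = (e0 + s)%N by rewrite subnKC.
  have top l := pdiff_iter_ddelta s (i := l) (G := G) (h := h)
    (fun r lt_er => etrans (congr1 (dsub G) (h_ord l r lt_er)) (rmorph0 _)).
  have Df0 : Dt (dsub G (iter s (@ddelta k P q) h)) = 0.
    by rewrite dsub_iter Rh iter_ddelta0.
  have rest w : w != (i0, t) ->
      (point_eval (P n) a \o dsub G) (pdiff w (iter s (@ddelta k P q) h)) *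
      Dt (dsub G (pX w)) = 0.
    case: w => [l r'] lr; rewrite /= dsubX /=.
    case: (ltnP t r') => [lt_tr|le_rt].
      by rewrite (top l).2 -?Et // rmorph0 mul0r.
    case: (eqVneq l i0) lr => [->|l_i0] lr; last first.
      by rewrite DtG ?mulr0 // (leq_trans le_rt).
    rewrite IHt ?mulr0 ?(leq_trans le_rt) //.
    by rewrite ltn_neqAle le_rt andbT; apply: contraNneq lr => ->.
  have /eqP := chain_rule_isolate (dDs _ G) Df0 rest.
  by rewrite /= {1}Et (top i0).1 mulf_eq0 (negbTE as0) /= dsubX => /eqP.
(* The equations [p j], differentiated, make it kill all x_j^(t), so it is zero. *)
have DtX j t : (t <= N)%N -> Dt (pX (j, t)) = 0.
  elim/ltn_ind: t => t IHt le_t; case: (ltnP t (e j)) => [lt_t|le_et].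
    apply: DL; rewrite !mem_cat; apply/orP; right; apply/orP; right.
    apply/flattenP; exists [seq pX (j, s) | s <- iota 0 (e j)].
      by apply/mapP; exists j; rewrite ?mem_enum.
    by apply: map_f; rewrite mem_iota.
  pose s := (t - e j)%N; have Et : t = (e j + s)%N by rewrite subnKC.
  pose K := extend G (pX (j, 0%N)).
  have [top topX] := pdiff_iter_ddelta s (eP j).2.
  have Df0 : Dt (dsub K (iter s (@ddelta k P q.+1) (p j))) = 0.
    by rewrite dsub_iter Rp iter_ddelta0.
  have rest w : w != (ord_max, t) ->
      (point_eval (P n) a \o dsub K) (pdiff w (iter s (@ddelta k P q.+1) (p j))) *
      Dt (dsub K (pX w)) = 0.
    case: w => [i r'] lr; rewrite /= dsubX /=.
    case: (unliftP ord_max i) lr => [l|] -> lr.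
      rewrite {2}/K extend_lift; case: (ltnP (b + s) r') => [lt_r|le_r].
        rewrite (pdiff_iter_ddelta s (e := b) _).2 // ?rmorph0 ?mul0r // => r1 lt_r1.
        by rewrite hb ?rmorph0.
      have le_r' : (r' <= N + b)%N.
        by rewrite (leq_trans le_r) // addnC leq_add2r (leq_trans _ le_t) ?leq_subr.
      by case: (eqVneq l i0) => [->|l_i0]; rewrite ?DtG0 ?DtG ?mulr0.
    rewrite {2}/K extend_max iter_ddeltaX add0n; case: (ltnP t r') => [lt_tr|le_rt].
      by rewrite topX -?Et // rmorph0 mul0r.
    rewrite IHt ?mulr0 ?(leq_trans le_rt) //.
    by rewrite ltn_neqAle le_rt andbT; apply: contraNneq lr => ->.
  have /eqP := chain_rule_isolate (dDs _ K) Df0 rest.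
  rewrite /= {1}Et top mulf_eq0 (negbTE (aT j)) /= dsubX /K extend_max.
  by rewrite iter_ddeltaX add0n => /eqP.
suff : D u = 0 by apply/eqP.
have le_uN : (val u.2 <= N)%N by rewrite -ltnS ltn_ord.
rewrite -(DtX u.1 _ le_uN) /Dt (bigD1 u) //= pdiffX eqxx rmorph1 mul1r.
rewrite big1 ?addr0 // => w w_u; rewrite pdiffX rmorph_nat.
case: eqP => [[E1 E2]|_]; last by rewrite mul0r.
by case/eqP: w_u; rewrite [w]surjective_pairing -E1 -(val_inj E2) -surjective_pairing.
Qed.
End Certificate.

(** * Independent systems have certificates *)

Section Completeness.
Variables (k : fieldType) (char0 : [pchar k] =i pred0).
Variable P : forall n : nat, polyAlg k ('I_n * nat)%type.

Lemma dsub_ext q n (G G' : 'I_q -> P n) h : G =1 G' -> dsub G h = dsub G' h.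
Proof.
move=> GG'; apply: (rmorph_ext _ _ (gen_all h)) => [a|v _].
  by rewrite !dsubC.
by rewrite !dsubX GG'.
Qed.

Lemma dependent_ext q n (G G' : 'I_q -> P n) : G =1 G' -> dependent G -> dependent G'.
Proof. by move=> GG' [h h0 Rh]; exists h; rewrite -?(dsub_ext h GG'). Qed.

(** Dependence of a subsystem is dependence of the system; the inclusion of
    polynomial algebras has a retraction, so a nonzero relation stays nonzero.
    *)
Lemma dependent_sub q q' n (s : 'I_q -> 'I_q') (G : 'I_q' -> P n) :
  injective s -> dependent (G \o s) -> dependent G.
Proof.
move=> s_inj [h h0 Rh].
pose inc : {rmorphism P q -> P q'} := peval (P q) (pC (P q')) (fun v => pX (s v.1, v.2)).
pose ret : {rmorphism P q' -> P q} := peval (P q') (pC (P q))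
  (fun v => if [pick j | s j == v.1] is Some j then pX (j, v.2) else 0).
have incC a : inc (pC (P q) a) = pC (P q') a by exact: pevalC.
have incX v : inc (pX v) = pX (s v.1, v.2) by exact: pevalX.
have incK : ret (inc h) = h.
  apply: (rmorph_ext (F := ret \o inc) (G := idfun) _ _ (gen_all h)) => /= [a|v _].
    by rewrite incC; exact: pevalC.
  rewrite incX /ret pevalX /=; case: pickP => [j /eqP /s_inj ->|/(_ v.1)].
    by case: v.
  by rewrite eqxx.
exists (inc h); first by apply: contraNneq h0 => E; rewrite -incK E rmorph0.
rewrite -[RHS]Rh.
apply: (rmorph_ext (F := dsub G \o inc) (G := dsub (G \o s)) _ _ (gen_all h)) => /= [a|v _].
  by rewrite incC !dsubC.
by rewrite incX !dsubX.
Qed.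

(** A minimal relation for the extended system involves the last variable,
    since otherwise it would be a relation for [G]; hence one of its partial
    derivatives in that variable is nonzero, and by minimality it is still
    nonzero after substitution. *)
Lemma extend_relation q n (G : 'I_q -> P n) (x : P n) :
  ~ dependent G -> dependent (extend G x) ->
  exists p r, dsub (extend G x) p = 0 /\ dsub (extend G x) (pdiff (ord_max, r) p) != 0.
Proof.
move=> indG /minimal_relation [p [p0 Rp minp]].
case: (classic (exists r, pdiff (ord_max, r) p != 0)) => [[r /minp pr]|no].
  by exists p, r.
case: indG; have gp : gen (pC (P q.+1)) pX (fun v => ~ (v.1 = ord_max)) p.
  apply: pgen_der => -[i r] /= ->.
  by apply/eqP/negPn/negP => pr; apply: no; exists r.
(* [drop_last p] is [p] with the last variable set to 0; it loses nothing, as [p]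
   does not involve that variable. *)
pose drop_last : {rmorphism P q.+1 -> P q} := peval (P q.+1) (pC (P q))
  (fun v => if unlift ord_max v.1 is Some i then pX (i, v.2) else 0).
pose lift_last : {rmorphism P q -> P q.+1} := peval (P q) (pC (P q.+1))
  (fun v => pX (lift ord_max v.1, v.2)).
have liftC a : lift_last (pC (P q) a) = pC (P q.+1) a by exact: pevalC.
have liftX v : lift_last (pX v) = pX (lift ord_max v.1, v.2) by exact: pevalX.
have dropK : lift_last (drop_last p) = p.
  apply: (rmorph_ext (F := lift_last \o drop_last) (G := idfun) _ _ gp) => /= [a|v].
    by rewrite -[RHS]liftC; congr (lift_last _); exact: pevalC.
  rewrite /drop_last pevalX; case: v => v r /=.
  by case: unliftP => [i ->|-> //]; rewrite liftX.
exists (drop_last p).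
  by apply: contraNneq p0 => E; rewrite -dropK E rmorph0.
rewrite -[RHS]Rp -[in RHS]dropK; set f := drop_last p.
apply: (rmorph_ext (G := dsub (extend G x) \o lift_last) _ _ (gen_all f)) => /= [a|v _].
  by rewrite liftC !dsubC.
by rewrite liftX !dsubX extend_lift.
Qed.

(** More polynomials than variables are algebraically dependent.  The
    polynomials [y v] are indexed by differential variables so that the
    relation found is a differential one. *)
Definition algebraic_counting := forall q n (y : 'I_q * nat -> P n)
    (s : seq ('I_q * nat)) (t : seq ('I_n * nat)),
  uniq s -> (size t < size s)%N ->
  (forall v, v \in s -> gen (pC (P n)) pX (fun w => w \in t) (y v)) ->
  exists2 h : P q, h != 0 & peval (P q) (pC (P n)) y h = 0.

Hypothesis count : algebraic_counting.

Lemma gen_ddelta n r (f : P n) :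
  gen (pC (P n)) pX (fun v => (v.2 <= r)%N) f ->
  gen (pC (P n)) pX (fun v => (v.2 <= r.+1)%N) (ddelta f).
Proof.
have dd := @ddelta_derivation k P n.
have up g : gen (pC (P n)) pX (fun v => (v.2 <= r)%N) g ->
    gen (pC (P n)) pX (fun v => (v.2 <= r.+1)%N) g.
  by apply: genS => v /leqW.
elim=> [a|v le_vr|g h _ IHg _ IHh|g h /up rg IHg /up rh IHh].
- by rewrite (derivationC dd) -(rmorph0 (pC (P n))); exact: gen_const.
- by rewrite ddeltaX; exact: gen_var.
- by rewrite (derivationD dd); exact: gen_add.
- by rewrite (derivationM dd); apply: gen_add; exact: gen_mul.
Qed.

(** The derivatives up to order N of q elements of order at most r number q (N
    + 1) and involve n (N + r + 1) variables; for q > n and N = n r the first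
    number is larger. *)
Lemma too_many_dependent q n (G : 'I_q -> P n) : (n < q)%N -> dependent G.
Proof.
move=> lt_nq.
have [r rG] : exists r, forall i, gen (pC (P n)) pX (fun v => (v.2 <= r)%N) (G i).
  have [s sG] := fin_all_exists (fun i => pgen_finite (G i)).
  exists (\max_i \max_(v <- s i) v.2)%N => i; apply: genS (sG i) => v v_s.
  apply: leq_trans (leq_bigmax i).
  exact: (leq_bigmax_seq _ v_s).
have rGs i t : gen (pC (P n)) pX (fun v => (v.2 <= r + t)%N) (iter t (@ddelta k P n) (G i)).
  by elim: t => [|t IHt]; [rewrite addn0; exact: rG | rewrite addnS; exact: gen_ddelta].
pose N := (n * r)%N.
have [||v|h h0 Rh] := count (y := fun v => iter v.2 (@ddelta k P n) (G v.1))
    (s := [seq (i, t) | i <- enum 'I_q, t <- iota 0 N.+1])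
    (t := [seq (j, t) | j <- enum 'I_n, t <- iota 0 (N + r).+1]).
- by apply: allpairs_uniq; rewrite ?enum_uniq ?iota_uniq // => -[? ?] [? ?].
- rewrite !size_allpairs !size_iota -!cardE !card_ord.
  apply: leq_trans (_ : (n.+1 * N.+1 <= _)%N); last by rewrite leq_mul2r lt_nq orbT.
  by rewrite /N; lia.
- case/allpairsP => -[i t] [_ t_N ->]; apply: genS (rGs i t) => -[j e] le_e.
  have {t_N} le_tN : (t <= N)%N by move: t_N; rewrite mem_iota.
  have {}le_e : (e <= N + r)%N by rewrite (leq_trans le_e) // addnC leq_add2r.
  by apply: allpairs_f; rewrite ?mem_enum ?mem_iota.
by exists h.
Qed.

(** A list as a system of [q] elements, so that systems can be concatenated. *)
Definition nthf n (G : seq (P n)) q (i : 'I_q) : P n := nth 0 G i.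

Lemma extend_nthf n (G : seq (P n)) (x : P n) :
  extend (nthf G (q := size G)) x =1 nthf (rcons G x) (q := (size G).+1).
Proof.
move=> i; rewrite /nthf nth_rcons /extend.
case: unliftP => [j ->|->] /=; last by rewrite ltnn eqxx.
by rewrite -[bump _ _]/(lift ord_max j : nat) lift_max ltn_ord.
Qed.

(** Variables are adjoined to [G] as long as the system stays independent. *)
Theorem certificate_exists n (G : seq (P n)) :
  ~ dependent (nthf G (q := size G)) ->
  exists J : seq 'I_n, let G' := G ++ [seq pX (j, 0%N) | j <- J] in
    (size G' <= n)%N /\ forall j : 'I_n, exists (p : P (size G').+1) r,
      dsub (nthf (rcons G' (pX (j, 0%N))) (q := (size G').+1)) p = 0 /\
      dsub (nthf (rcons G' (pX (j, 0%N))) (q := (size G').+1)) (pdiff (ord_max, r) p) != 0.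
Proof.
have bound (H : seq (P n)) : ~ dependent (nthf H (q := size H)) -> (size H <= n)%N.
  by rewrite leqNgt => indH; apply/negP => /too_many_dependent.
move: {-1}(n - size G)%N (leqnn (n - size G)) => d.
elim: d G => [|d IHd] G le_d indG; have le_Gn := bound G indG.
  exists [::]; rewrite /= cats0; split=> // j.
  have [|p [r [Rp pr]]] := extend_relation indG (x := pX (j, 0%N)).
    apply: (dependent_ext (fun i => esym (@extend_nthf _ G _ i))); apply: too_many_dependent.
    by rewrite ltnS -subn_eq0 -leqn0.
  by exists p, r; rewrite -!(dsub_ext _ (@extend_nthf _ G _)).
case: (classic (exists j : 'I_n,
    ~ dependent (nthf (rcons G (pX (j, 0%N))) (q := (size G).+1)))) => [[j indj]|alldep].
  rewrite -[(size G).+1](size_rcons G (pX (j, 0%N) : P n)) in indj.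
  have [|J HJ] := IHd _ _ indj; first by rewrite size_rcons; lia.
  by exists (j :: J); rewrite /= -cat_rcons.
exists [::]; rewrite /= cats0; split=> // j.
have [|p [r [Rp pr]]] := extend_relation indG (x := pX (j, 0%N)).
  apply: (dependent_ext (fun i => esym (@extend_nthf _ G _ i))).
  by apply: NNPP => indj; apply: alldep; exists j.
by exists p, r; rewrite -!(dsub_ext _ (@extend_nthf _ G _)).
Qed.
End Completeness.

(** * Weights and homogeneous relations *)

Lemma intr_eq0_char0 (k : fieldType) : [pchar k] =i pred0 ->
  forall w : int, w%:~R = 0 :> k -> w = 0.
Proof.
move=> char0 w; have nat0 n : n%:R = 0 :> k -> n = 0%N.
  by have /charf0P E := char0 => /eqP; rewrite E => /eqP.
case: w => n; first by rewrite -pmulrn => /nat0 ->.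
by rewrite NegzE mulrNz -pmulrn => /eqP; rewrite oppr_eq0 => /eqP /nat0.
Qed.

Section Weights.
Variables (k : fieldType) (char0 : [pchar k] =i pred0).
Variable P : forall n : nat, polyAlg k ('I_n * nat)%type.
Variable n : nat.
Implicit Types (a b f g h : P n) (w : int).
Local Notation delta := (@ddelta k P n).

(** For this weight N_0 is the homogeneous part of weight 1. *)
Definition var_weight (v : 'I_n * nat) : int := 1 - v.2%:Z.

(** The Euler operator of the weight; its eigenvectors are the homogeneous
    polynomials. *)
Definition euler : P n -> P n := pder (fun v => (var_weight v)%:~R * pX v).

Definition homogeneous w f : Prop := euler f = w%:~R * f.

Lemma euler_derivation : derivation (pC (P n)) (fun f => f) euler.
Proof. exact: pder_derivation. Qed.

Lemma derivation_int (A : comNzRingType) (F D : P n -> A) w :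
  derivation (pC (P n)) F D -> D (w%:~R) = 0.
Proof. by case=> _ _ DC; rewrite -(rmorph_int (pC (P n))) DC. Qed.

(** The derivation lowers the weight by one. *)
Lemma euler_ddelta f : euler (delta f) = delta (euler f) - delta f.
Proof.
apply/eqP; rewrite -subr_eq0 opprB addrA addrAC addr_eq0; apply/eqP.
have dB := derivation_bracket euler_derivation (@ddelta_derivation k P n).
have dN : derivation (pC (P n)) (fun f => f) (fun f => - delta f).
  case: (@ddelta_derivation k P n) => DD DM DC; split=> [g h|g h|c].
  - by rewrite DD opprD.
  - by rewrite DM opprD mulrN mulNr.
  - by rewrite DC oppr0.
apply: (derivation_ext dB dN _ (gen_all f)) => v _.
rewrite ddeltaX /euler !pderX (derivationM (@ddelta_derivation k P n)) ddeltaX.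
rewrite (derivation_int _ (@ddelta_derivation k P n)) mul0r addr0 -mulrBl.
rewrite /var_weight /= -rmorphB /= -add1n PoszD.
have -> : 1 - (1 + v.2%:Z) - (1 - v.2%:Z) = -1 :> int by ring.
by rewrite mulN1r.
Qed.

Lemma homogeneousM w1 w2 f g :
  homogeneous w1 f -> homogeneous w2 g -> homogeneous (w1 + w2) (f * g).
Proof.
rewrite /homogeneous (derivationM euler_derivation) => -> ->.
by rewrite rmorphD /=; ring.
Qed.

Lemma homogeneousB w f g :
  homogeneous w f -> homogeneous w g -> homogeneous w (f - g).
Proof.
by rewrite /homogeneous (derivationB _ _ euler_derivation) => -> ->; rewrite mulrBr.
Qed.

Lemma homogeneous_ddelta w f : homogeneous w f -> homogeneous (w - 1) (delta f).
Proof.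
rewrite /homogeneous euler_ddelta => ->.
rewrite (derivationM (@ddelta_derivation k P n)).
rewrite (derivation_int _ (@ddelta_derivation k P n)) mul0r addr0.
by rewrite rmorphB /=; ring.
Qed.

(** That [D] kills b / a, without denominators. *)
Definition proportional (D : P n -> P n) a b : Prop := a * D b = D a * b.

(** If two derivations kill the fraction b / a then so does their bracket. *)
Lemma proportional_bracket (D E : P n -> P n) a b :
  derivation (pC (P n)) (fun f => f) D -> derivation (pC (P n)) (fun f => f) E ->
  b != 0 -> proportional D a b -> proportional E a b ->
  proportional (fun f => D (E f) - E (D f)) a b.
Proof.
move=> dD dE b0 pD pE; rewrite /proportional.
have e1 := congr1 D pE; rewrite !(derivationM dD) in e1.
have e2 := congr1 E pD; rewrite !(derivationM dE) in e2.
(* Both sides are equal to a (D b) (E b) / b. *)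
have e3 : D a * E b = E a * D b.
  apply: (pmulfI char0 b0).
  have -> : b * (D a * E b) = (D a * b) * E b by ring.
  have -> : b * (E a * D b) = (E a * b) * D b by ring.
  by rewrite -pD -pE; ring.
rewrite mulrBr mulrBl.
have -> : a * D (E b) = E a * D b + D (E a) * b - D a * E b by rewrite -e1; ring.
have -> : a * E (D b) = D a * E b + E (D a) * b - E a * D b by rewrite -e2; ring.
by rewrite e3; ring.
Qed.

(** A constant fraction b / a is killed by the partial derivatives of large
    order, and then by all of them by descending induction on the order, since
    the partial derivative in x_i^(r) is the bracket of the one in x_i^(r+1)
    with the derivation.  Hence it is killed by the Euler operator, which
    multiplies it by the difference of the weights. *)
Lemma ddelta_proportional_weight w1 w2 a b : a != 0 -> b != 0 ->
  homogeneous w1 a -> homogeneous w2 b -> proportional delta a b -> w1 = w2.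
Proof.
move=> a0 b0 ha hb pab.
have [N1 oa] := pdiff_order a; have [N2 ob] := pdiff_order b.
(* Descending induction on the order [r], starting above the orders of [a] and
   [b]. *)
have pall d i r : (maxn N1 N2 < r + d)%N -> proportional (pdiff (i, r)) a b.
  elim: d r => [|d IHd] r; first rewrite addn0 gtn_max => /andP [lt1 lt2].
    by rewrite /proportional oa // ob // mulr0 mul0r.
  rewrite addnS -addSn => /IHd pr.
  have := proportional_bracket (pdiff_derivation (P n) (i, r.+1))
    (@ddelta_derivation k P n) b0 pr pab.
  have bracketE f : pdiff (i, r.+1) (delta f) - delta (pdiff (i, r.+1) f) = pdiff (i, r) f.
    by rewrite pdiff_ddeltaS addrAC subrr add0r.
  by rewrite /proportional !bracketE.
have peuler : proportional euler a b.
  have [s1 g1] := pgen_finite a; have [s2 g2] := pgen_finite b.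
  pose s := undup (s1 ++ s2).
  have us : uniq s by exact: undup_uniq.
  have ga : gen (pC (P n)) pX (fun v => v \in s) a.
    by apply: genS g1 => v vs; rewrite mem_undup mem_cat vs.
  have gb : gen (pC (P n)) pX (fun v => v \in s) b.
    by apply: genS g2 => v vs; rewrite mem_undup mem_cat vs orbT.
  rewrite /proportional (chain_rule (F := idfun) euler_derivation us ga).
  rewrite (chain_rule (F := idfun) euler_derivation us gb) /=.
  rewrite mulr_sumr mulr_suml; apply: eq_bigr => -[i r] _.
  have := pall (maxn N1 N2).+1 i r; rewrite /proportional => E.
  by rewrite mulrA E ?addnS ?ltnS ?leq_addl // mulrAC.
have : (w2 - w1)%:~R * (a * b) = 0.
  by move: peuler; rewrite /proportional ha hb rmorphB /= => E; rewrite mulrBl; apply/eqP;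
    rewrite subr_eq0; apply/eqP; rewrite -[RHS]mulrA in E; rewrite -[RHS]E; ring.
case/(pmulf_eq0 char0) => [|ab0]; last first.
  by have := pmulf_neq0 char0 a0 b0; rewrite ab0 eqxx.
rewrite -(rmorph_int (pC (P n))) => /eqP; rewrite fmorph_eq0 => /eqP.
by move=> /(intr_eq0_char0 char0) /eqP; rewrite subr_eq0 => /eqP.
Qed.

(** Elimination of the components one at a time: for a component [a0] of a
    relation [h], the relation [a0 * ddelta h - ddelta a0 * h] has one
    component fewer. *)
Lemma homogeneous_relation m (G : 'I_n -> P m) (s : seq (int * P n)) :
  s != [::] -> uniq (map fst s) ->
  (forall x, x \in s -> x.2 != 0 /\ homogeneous x.1 x.2) ->
  dsub G (\sum_(x <- s) x.2) = 0 ->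
  exists w h, [/\ h != 0, homogeneous w h & dsub G h = 0].
Proof.
move: {-1}(size s) (leqnn (size s)) => d.
elim: d s => [|d IHd] [|[w0 a0] s] //= le_s _ /andP [w0s us] hs.
rewrite big_cons /=; set S := \sum_(x <- s) _ => RS.
have [a0N0 ha0] := hs _ (mem_head _ _); rewrite /= in a0N0 ha0.
case: (eqVneq s [::]) => [s0|sN0].
  by exists w0, a0; split=> //; move: RS; rewrite /S s0 big_nil addr0.
have {}hs x : x \in s -> x.2 != 0 /\ homogeneous x.1 x.2.
  by move=> xs; apply: hs; rewrite in_cons xs orbT.
(* [W a0] = 0, so applying [W] to the whole relation removes [a0]. *)
pose W b := a0 * delta b - delta a0 * b.
apply: (IHd [seq (w0 + x.1 - 1, W x.2) | x <- s]).
- by rewrite size_map.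
- by rewrite -size_eq0 size_map size_eq0.
- rewrite -map_comp (eq_map (g := (fun w => w0 + w - 1) \o fst)) // map_comp.
  by rewrite map_inj_uniq // => w1 w2 /addIr /addrI.
- move=> _ /mapP [x xs ->] /=; have [xN0 hx] := hs _ xs; split.
    apply/eqP => /eqP; rewrite subr_eq0 => /eqP pax.
    (* [W x.2] = 0 would force equal weights, but the weights are distinct. *)
    have Ew := ddelta_proportional_weight a0N0 xN0 ha0 hx pax.
    by case/negP: w0s; rewrite Ew; apply: map_f.
  apply: homogeneousB.
    by rewrite -addrA; apply: homogeneousM ha0 _; apply: homogeneous_ddelta.
  rewrite addrAC; apply: homogeneousM; last exact: hx.
  exact: homogeneous_ddelta.
have -> : \sum_(x <- [seq (w0 + x.1 - 1, W x.2) | x <- s]) x.2 = W (a0 + S).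
  have dd := @ddelta_derivation k P n.
  rewrite big_map /= /W (derivationD dd) /S.
  have -> : delta (\sum_(x <- s) x.2) = \sum_(x <- s) delta x.2.
    by elim/big_rec2: _ => [|x y1 y2 _ <-]; rewrite ?ddelta0 // (derivationD dd).
  rewrite sumrB -!mulr_sumr; ring.
by rewrite /W rmorphB !rmorphM dsub_ddelta RS ddelta0 !mulr0 subrr.
Qed.
End Weights.

(** * The finitely supported polynomials *)

(** The term of variable w in the Leibniz rule for a product with a variable v:
    [b] tells whether w = v, and [n] is the exponent of w in the other factor.
    At [n] = 0 the quotient by w need not factor, but it has coefficient 0. *)
Lemma leibniz_term (R : comNzRingType) (x z d a : R) (b n : nat) :
  (n != 0%N -> x = z * d) ->
  (x * a) *+ (b + n) = (x * a) *+ b + z * (d * a *+ n).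
Proof.
rewrite mulrnDr; case: (n =P 0%N) => [-> _|_ ->//].
  by rewrite !mulr0n mulr0.
by rewrite mulrnAr mulrA.
Qed.

Lemma add_swap (V : zmodType) (a b c d : V) : a = d -> b = c -> a + b = c + d.
Proof. by move=> -> ->; rewrite addrC. Qed.

Lemma mulr_true_add0 (R : comNzRingType) (a b : R) : a * b *+ true + 0 = b * a.
Proof. by rewrite addr0 mulrC. Qed.

Section Leibniz.
Variables (R : comNzRingType) (A : comAlgType R).
Implicit Types (a : R) (x y d e f g : A).

Lemma leibnizDr x y d e f g h : h = d + e ->
  x * d + y * f + (x * e + y * g) = x * h + y * (f + g).
Proof. by move=> ->; rewrite !mulrDr addrACA. Qed.

Lemma leibnizZr a x y d f h : h = a *: d ->
  a *: (x * d + y * f) = x * h + y * (a *: f).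
Proof. by move=> ->; rewrite scalerDr -!scalerAr. Qed.

Lemma leibnizDl x y d e f g h : h = y + g ->
  x * d + y * f + (e * d + g * f) = (x + e) * d + h * f.
Proof. by move=> ->; rewrite !mulrDl addrACA. Qed.

Lemma leibnizZl a x y d f h : h = a *: y ->
  a *: (x * d + y * f) = (a *: x) * d + h * f.
Proof. by move=> ->; rewrite scalerDr -!scalerAl. Qed.

Lemma leibnizM x y d e f g h : h = x * e + y * f ->
  x * (f * d + e * g) + y * (f * g) = (x * f) * d + h * g.
Proof. by move=> ->; rewrite mulrDr mulrDl !mulrA addrA. Qed.
End Leibniz.

Section Polynomials.
Local Open Scope fset_scope.
Local Open Scope ring_scope.
Variables (k : fieldType) (I : choiceType).
Local Notation P := {malg k[{cmonom I}]}.
Implicit Types (m : {cmonom I}) (f g h : P) (v w : I).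

Definition pvar v : P := << (ucm v : {cmonom I}) >>.

Definition vars_in (V : I -> Prop) f : Prop :=
  forall m, m \in msupp f -> forall v, m v != 0%N -> V v.

Lemma monomM m1 m2 : << mmul m1 m2 >> = << m1 >> * << m2 >> :> P.
Proof. by rewrite malgM_def fgmulUU mulr1. Qed.

Lemma monomZ (a : k) m : << a *g m >> = a *: << m >> :> P.
Proof. by rewrite -mul_malgC malgM_def fgmulUU mul1m mulr1. Qed.

Lemma ucm_divcm m v : m v != 0%N -> mmul (ucm v) (divcm m (ucm v)) = m.
Proof.
move=> mv; apply/eqP/cmP => w; rewrite cmM divcmE ucmE addnC subnK //.
by case: eqP => // <-; rewrite lt0n.
Qed.

Lemma divcm_ucm m v : divcm (mmul (ucm v) m) (ucm v) = m.
Proof. by apply/eqP/cmP => w; rewrite divcmE cmM addKn. Qed.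

(** Monomials are built by multiplying by one variable at a time. *)
Lemma monom_rect_prop (Q : {cmonom I} -> Prop) :
  Q (mone : {cmonom I}) -> (forall v m, Q m -> Q (mmul (ucm v) m)) -> forall m, Q m.
Proof.
move=> Q1 QM m; move: {-1}(mdeg m) (erefl (mdeg m)) => d.
elim: d m => [|d IHd] m Em; first by rewrite (mdeg_eq0I Em).
have [v v_m] : exists v, v \in finsupp (cmonom_val m).
  apply/fset0Pn; apply/eqP => m0.
  by move: Em; rewrite mdegE m0 big_nil.
move: v_m; rewrite -cmE_neq0 => /ucm_divcm Dm; rewrite -Dm; apply/QM/IHd.
by apply: succn_inj; rewrite -Em -{2}Dm mdegM mdegU.
Qed.

Lemma poly_lin_ind (Q : P -> Prop) :
  Q 0 -> (forall f g, Q f -> Q g -> Q (f + g)) ->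
  (forall (c : k) f, Q f -> Q (c *: f)) ->
  forall f, (forall m, m \in msupp f -> Q << m >>) -> Q f.
Proof.
move=> Q0 QD QZ f Qm; rewrite [f]monalgE.
have QE m : m \in msupp f -> Q << f@_m *g m >>.
  by move=> m_f; rewrite monomZ; exact/QZ/Qm.
by rewrite big_seq; elim/big_ind: _.
Qed.

Lemma poly_ind_in (V : I -> Prop) (Q : P -> Prop) :
  Q 0 -> (forall f g, Q f -> Q g -> Q (f + g)) ->
  (forall (c : k) f, Q f -> Q (c *: f)) -> Q 1 ->
  (forall v f, V v -> Q f -> Q (pvar v * f)) ->
  forall f, vars_in V f -> Q f.
Proof.
move=> Q0 QD QZ Q1 QX f Vf; apply: (poly_lin_ind Q0 QD QZ) => m /Vf {Vf}.
elim/monom_rect_prop: m => [_|v m IHm Vm]; [exact: Q1 | rewrite monomM].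
apply: QX; first by apply: Vm; rewrite cmM cmUU.
by apply: IHm => w mw; apply: Vm; rewrite cmM addn_eq0 negb_and mw orbT.
Qed.

Lemma poly_ind (Q : P -> Prop) :
  Q 0 -> (forall f g, Q f -> Q g -> Q (f + g)) ->
  (forall (c : k) f, Q f -> Q (c *: f)) -> Q 1 ->
  (forall v f, Q f -> Q (pvar v * f)) -> forall f, Q f.
Proof.
move=> Q0 QD QZ Q1 QX f; apply: (@poly_ind_in (fun=> True) Q Q0 QD QZ Q1) => [v g _|//].
exact: QX.
Qed.

Lemma scaleMP (c : k) f : c *: f = c%:MP * f.
Proof. by rewrite mul_malgC. Qed.

Section Evaluation.
Variables (A : comNzRingType) (c : {rmorphism k -> A}) (x : I -> A).

Definition monom_eval m : A := \prod_(v <- finsupp (cmonom_val m)) x v ^+ m v.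

Lemma monom_evalEw (d : {fset I}) m : finsupp (cmonom_val m) `<=` d ->
  monom_eval m = \prod_(v <- d) x v ^+ m v.
Proof.
move=> le; rewrite /monom_eval (big_fset_incl _ le) // => v _.
by rewrite -cmE_neq0 negbK => /eqP ->.
Qed.

Lemma monom_eval_morph : mmorphism monom_eval.
Proof.
split=> [m1 m2|]; last by rewrite /monom_eval mdom1 big_seq_fset0.
rewrite {1}/monom_eval mdomD.
rewrite (monom_evalEw (fsubsetUl _ (finsupp (cmonom_val m2)))).
rewrite (monom_evalEw (fsubsetUr (finsupp (cmonom_val m1)) _)).
by rewrite -big_split; apply: eq_bigr => v _; rewrite cmM exprD.
Qed.
HB.instance Definition _ :=
  isMultiplicative.Build {cmonom I} A monom_eval monom_eval_morph.

Definition malg_eval : P -> A := mmap c monom_eval.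
HB.instance Definition _ := GRing.RMorphism.on malg_eval.

Lemma malg_evalX v : malg_eval (pvar v) = x v.
Proof.
rewrite /malg_eval /pvar mmapU -[X in X * _]/(c 1) rmorph1 mul1r /monom_eval mdomU big_seq_fset1.
by rewrite cmUU.
Qed.

Lemma malg_evalC (a : k) : malg_eval a%:MP = c a.
Proof. exact: mmapC. Qed.

End Evaluation.

Definition monom_der (u : I -> P) m : P :=
  \sum_(v <- finsupp (cmonom_val m)) (<< divcm m (ucm v) >> * u v) *+ m v.

(** The defining formula of [delta], with arbitrary values [u] on the
    variables. *)
Definition der (u : I -> P) f : P :=
  \sum_(m <- msupp f) \sum_(v <- finsupp (cmonom_val m))
    (f@_m *+ m v) *: (<< (divcm m (ucm v) : {cmonom I}) >> * u v).

Lemma mulMn_scale (a : k) f n : (a *+ n) *: f = a%:MP * (f *+ n).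
Proof. by rewrite -scalerMnl scaleMP mulrnAr. Qed.

Lemma derE u f : der u f = mmap (@mkmalgU _ k (mone : {cmonom I})) (monom_der u) f.
Proof.
rewrite /der mmapE; apply: eq_bigr => m _; rewrite /monom_der [RHS]mulr_sumr.
apply: eq_bigr => v _; exact: mulMn_scale.
Qed.

Lemma derD u f g : der u (f + g) = der u f + der u g.
Proof. by rewrite [LHS]derE raddfD /= -!derE. Qed.

Lemma der_monom u m : der u << m >> = monom_der u m.
Proof. by rewrite derE mmapU; exact: mul1r. Qed.

Lemma derC u (a : k) : der u a%:MP = 0.
Proof. by rewrite derE mmapU /monom_der mdom1 big_seq_fset0; exact: mulr0. Qed.

Lemma derZ u (a : k) f : der u (a *: f) = a *: der u f.
Proof.
rewrite !derE [RHS]scaleMP !mmapE; have [->|a0] := eqVneq a 0.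
  by rewrite scale0r msupp0 big_seq_fset0 malgC0E; symmetry; exact: mul0r.
rewrite msuppZ (negbTE a0) [RHS]mulr_sumr; apply: eq_bigr => m _.
by rewrite mcoeffZ mpolyCM; symmetry; exact: mulrA.
Qed.

Lemma monom_derEw u (d : {fset I}) m : finsupp (cmonom_val m) `<=` d ->
  monom_der u m = \sum_(v <- d) (<< divcm m (ucm v) >> * u v) *+ m v.
Proof.
move=> le; rewrite /monom_der (big_fset_incl _ le) // => v _.
by rewrite -cmE_neq0 negbK => /eqP ->.
Qed.

(** The Leibniz rule for a variable times a monomial, from which the general
    rule follows by linearity and induction. *)
Lemma monom_derX u v m :
  monom_der u (mmul (ucm v) m) = << ucm v >> * monom_der u m + u v * << m >>.
Proof.
have le := fsubsetUr [fset v] (finsupp (cmonom_val m)).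
rewrite {1}/monom_der mdomD mdomU (monom_derEw u le) [in RHS]mulr_sumr.
have v_d : v \in [fset v] `|` finsupp (cmonom_val m) by rewrite !inE eqxx.
transitivity (\sum_(w <- [fset v] `|` finsupp (cmonom_val m))
    ((<< divcm (mmul (ucm v) m) (ucm w) >> * u w) *+ (v == w) +
     << ucm v >> * (<< divcm m (ucm w) >> * u w *+ m w))).
  apply: eq_bigr => w _; rewrite cmM ucmE; apply: leibniz_term => mw.
  rewrite -monomM; apply: (congr1 (fun z => << z >>)).
  apply/eqP/cmP => z; rewrite divcmE !cmM divcmE addnBA //.
  by rewrite ucmE; case: eqP => // <-; rewrite lt0n.
rewrite big_split /=; apply: add_swap; last by [].
rewrite (big_fsetD1 v v_d) /= divcm_ucm eqxx big1_fset; first exact: mulr_true_add0.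
by move=> w; rewrite in_fsetD1 eq_sym => /andP [/negbTE -> _] _.
Qed.

Lemma der_var u v : der u (pvar v) = u v.
Proof.
rewrite /pvar der_monom /monom_der mdomU big_seq_fset1 cmUU mulr1n.
suff -> : divcm (ucm v) (ucm v) = mone by exact: mul1r.
by apply/eqP/cmP => w; rewrite divcmE subnn cm1.
Qed.

Lemma der0 u : der u 0 = 0.
Proof. by rewrite -[0 in LHS]malgC0E derC. Qed.

Lemma derX u v f : der u (pvar v * f) = pvar v * der u f + u v * f.
Proof.
pose Q h := der u (pvar v * h) = pvar v * der u h + u v * h.
apply: (@poly_lin_ind Q); rewrite /Q {Q}.
- by rewrite [pvar v * 0]mulr0 der0 [X in _ = X + _]mulr0 [X in _ = _ + X]mulr0 addr0.
- move=> f1 f2 E1 E2; apply: etrans (congr1 (der u) (mulrDr _ f1 f2)) _.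
  apply: etrans (derD u _ _) _; apply: etrans (congr2 +%R E1 E2) _.
  exact: leibnizDr (derD u f1 f2).
- move=> a f1 E; apply: etrans (congr1 (der u) (esym (scalerAr a _ f1))) _.
  apply: etrans (derZ u a _) _; apply: etrans (congr1 ( *:%R a) E) _.
  exact: leibnizZr (derZ u a f1).
- move=> m _; rewrite (der_monom u m).
  apply: etrans (congr1 (der u) (esym (monomM (ucm v) m))) _.
  exact: etrans (der_monom u _) (monom_derX u v m).
Qed.

Lemma derM u f g : der u (f * g) = f * der u g + der u f * g.
Proof.
pose Q h := der u (h * g) = h * der u g + der u h * g.
move: f; apply: (@poly_ind Q); rewrite /Q {Q}.
- by rewrite [0 * g]mul0r der0 [X in _ = X + _]mul0r [X in _ = _ + X]mul0r addr0.
- move=> f1 f2 E1 E2; apply: etrans (congr1 (der u) (mulrDl f1 f2 g)) _.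
  apply: etrans (derD u _ _) _; apply: etrans (congr2 +%R E1 E2) _.
  exact: leibnizDl (derD u f1 f2).
- move=> a f1 E; apply: etrans (congr1 (der u) (esym (scalerAl a f1 g))) _.
  apply: etrans (derZ u a _) _; apply: etrans (congr1 ( *:%R a) E) _.
  exact: leibnizZl (derZ u a f1).
- rewrite [1 * g]mul1r [1 * der u g]mul1r.
  by rewrite -[der u 1]/(der u 1%:MP) derC [0 * g]mul0r addr0.
- move=> v f1 E; apply: etrans (congr1 (der u) (esym (mulrA _ f1 g))) _.
  apply: etrans (derX u v _) _.
  apply: etrans (congr1 (fun z => pvar v * z + _) E) _.
  exact: leibnizM (derX u v f1).
Qed.

Lemma der_derivation u : derivation (fun a : k => a%:MP) (fun f => f) (der u).
Proof. by split; [exact: derD | exact: derM | exact: derC]. Qed.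
End Polynomials.

Lemma sum_pick (R : comNzRingType) (I : choiceType) (d : {fset I}) (a : I -> R)
    (n : I -> nat) (v : I) :
  (v \notin d -> n v = 0%N) ->
  \sum_(w <- d) (a w * (w == v)%:R) *+ n w = a v *+ n v.
Proof.
move=> n0; have [v_d|v_d] := boolP (v \in d).
  rewrite (big_fsetD1 v v_d) /= eqxx mulr1 big1_fset ?addr0 //.
  by move=> w; rewrite in_fsetD1 => /andP [/negbTE -> _] _; rewrite mulr0 mul0rn.
rewrite (n0 v_d) mulr0n big1_fset // => w w_d _; case: (w =P v) => [Ewv|_].
  by rewrite -Ewv w_d in v_d.
by rewrite mulr0 mul0rn.
Qed.

Section Partial.
Local Open Scope fset_scope.
Local Open Scope ring_scope.
Variables (k : fieldType) (I : choiceType).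
Local Notation P := {malg k[{cmonom I}]}.
Implicit Types (m : {cmonom I}) (f g h : P) (v w : I).

Definition partial v : P -> P := der (fun w => (w == v)%:R).

Lemma partial_monom v m : partial v << m >> = << divcm m (ucm v) >> *+ m v.
Proof.
rewrite /partial der_monom; apply: sum_pick => v_m.
by apply/eqP; rewrite cmE_eq0.
Qed.

(** Two consequences are drawn from this formula: partial derivatives lower the
    degree, and in characteristic zero a variable that occurs has a nonzero
    partial derivative. *)
Lemma mcoeff_partial v f m :
  (partial v f)@_m = f@_(mmul (ucm v) m) *+ (m v).+1.
Proof.
pose Q h := (partial v h)@_m = h@_(mmul (ucm v) m) *+ (m v).+1.
apply: (@poly_lin_ind _ _ Q); rewrite /Q {Q}.
- by rewrite /partial der0 !mcoeff0 mul0rn.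
- move=> f1 f2 E1 E2; apply: etrans (congr1 (mcoeff m) (derD _ f1 f2)) _.
  apply: etrans (mcoeffD _ _ _) _; apply: etrans (congr2 +%R E1 E2) _.
  by rewrite mcoeffD mulrnDl.
- move=> a f1 E1; apply: etrans (congr1 (mcoeff m) (derZ _ a f1)) _.
  apply: etrans (mcoeffZ _ _ _) _; apply: etrans (congr1 ( *%R a) E1) _.
  by rewrite mcoeffZ mulrnAr.
- move=> m0 _; rewrite partial_monom mcoeffMn mcoeffU mcoeffU.
  have [m0v|m0v] := eqVneq (m0 v) 0%N.
    case: (m0 =P mmul (ucm v) m) => [E|_]; last by rewrite m0v !mul0rn.
    by move: m0v; rewrite E cmM cmUU.
  have -> : (divcm m0 (ucm v) == m) = (m0 == mmul (ucm v) m).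
    apply/eqP/eqP => [<-|->]; first by rewrite ucm_divcm.
    exact: divcm_ucm.
  case: (m0 =P _) => [->|_]; last by rewrite !mul0rn.
  by rewrite cmM cmUU.
Qed.

Lemma msize_partial v f : f != 0 -> (msize (partial v f) < msize f)%N.
Proof.
move=> f0; have fS := malgSpred mdeg f0; rewrite fS ltnS /mmeasure.
apply/bigmax_leqP_seq => m; rewrite -mcoeff_neq0 mcoeff_partial => m_f _.
have: mmul (ucm v) m \in msupp f.
  by rewrite -mcoeff_neq0; apply: contraNneq m_f => ->; rewrite mul0rn.
move=> /(mmeasure_mnm_lt mdeg); rewrite fS.
by rewrite -[X in (X < _)%N]/(mdeg (mmul (ucm v) m)) mdegM mdegU add1n.
Qed.

Local Notation gen := (gen (fun a : k => a%:MP : P) (@pvar k I)).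

Lemma vars_in_gen (V : I -> Prop) f : vars_in V f -> gen V f.
Proof.
have g0 : gen V 0 by rewrite -malgC0E; exact: gen_const.
move: f; apply: poly_ind_in => //.
- exact: gen_add.
- by move=> a f gf; rewrite -mul_malgC; apply: gen_mul => //; apply: gen_const.
- exact: (gen_const _ _ _ 1).
- by move=> v f Vv gf; apply: gen_mul => //; apply: gen_var.
Qed.

Lemma gen_finite f : exists s : seq I, gen (fun v => v \in s) f.
Proof.
exists (flatten [seq (finsupp (cmonom_val m) : seq I) | m <- msupp f]).
apply: vars_in_gen => m m_f v; rewrite cmE_neq0 => v_m.
by apply/flatten_mapP; exists m.
Qed.

Hypothesis char0 : [pchar k] =i pred0.

Lemma gen_partial (W : I -> Prop) f :
  (forall v, W v -> partial v f = 0) -> gen (fun v => ~ W v) f.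
Proof.
move=> f0; apply: vars_in_gen => m m_f v mv /f0 /malgP /(_ (divcm m (ucm v))).
rewrite mcoeff_partial ucm_divcm // mcoeff0 divcmE ucmE eqxx -mulr_natr.
move/eqP; rewrite mulf_eq0 mcoeff_eq0 m_f /=.
by have /charf0P -> := char0.
Qed.

(** The finitely supported functions on monomials are an instance. *)
Definition malg_polyAlg : polyAlg k I :=
  @PolyAlg k I {malg k[{cmonom I}]} (@mkmalgU {cmonom I} k mone) (@pvar k I)
    (fun A c x => malg_eval c x) (@malg_evalC k I) (@malg_evalX k I)
    (@der k I) (@der_derivation k I) (@der_var k I) gen_finite
    (fun f => msize f) msize_partial gen_partial.
End Partial.

(** * Counting monomials *)

Section Bounded.
Local Open Scope fset_scope.
Local Open Scope ring_scope.
Variables (k : fieldType) (I : choiceType) (t : seq I).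
Local Notation P := {malg k[{cmonom I}]}.
Implicit Types (m : {cmonom I}) (f g h : P) (v w : I).

Definition bounded (B : nat) f : Prop :=
  forall m, m \in msupp f -> forall v, (m v <= if v \in t then B else 0)%N.

Lemma boundedS B C f : (B <= C)%N -> bounded B f -> bounded C f.
Proof.
move=> le_BC Bf m /Bf mB v; apply: leq_trans (mB v) _; by case: ifP.
Qed.

Lemma boundedD B f g : bounded B f -> bounded B g -> bounded B (f + g).
Proof.
move=> Bf Bg m /(fsubsetP (msuppD_le f g)); rewrite in_fsetU.
by case/orP => [/Bf|/Bg].
Qed.

Lemma boundedC (c : k) : bounded 0 c%:MP.
Proof.
move=> m /(fsubsetP (msuppC_le c)); rewrite in_fset1 => /eqP -> v.
by rewrite cm1; case: ifP.
Qed.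

Lemma bounded1 B : bounded B 1.
Proof. by apply: (boundedS (leq0n B)); rewrite -mpolyC1E; exact: boundedC. Qed.

Lemma boundedX v : v \in t -> bounded 1 (pvar k v).
Proof.
move=> v_t m; rewrite /pvar msuppU oner_eq0 in_fset1 => /eqP -> w.
by rewrite ucmE; case: eqP => [<-|_]; rewrite ?v_t //; case: ifP.
Qed.

Lemma boundedM B C f g : bounded B f -> bounded C g -> bounded (B + C) (f * g).
Proof.
move=> Bf Cg m /msuppM_le [m1 [m2 [/Bf B1 /Cg C2 ->]]] v.
have := leq_add (B1 v) (C2 v); rewrite cmM.
by case: ifP.
Qed.

Lemma boundedXn B f n : bounded B f -> bounded (n * B) (f ^+ n).
Proof.
move=> Bf; elim: n => [|n IHn]; first exact: bounded1.
by rewrite mulSn exprS; apply: boundedM.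
Qed.

Lemma bounded_prod (J : eqType) (s : seq J) (F : J -> P) B :
  (forall j, j \in s -> bounded B (F j)) ->
  bounded (size s * B) (\prod_(j <- s) F j).
Proof.
elim: s => [|j s IHs] Fs; first by rewrite big_nil; exact: bounded1.
rewrite big_cons mulSn; apply: boundedM; first by apply: Fs; rewrite mem_head.
by apply: IHs => i i_s; apply: Fs; rewrite in_cons i_s orbT.
Qed.

Lemma gen_bounded f :
  gen (fun a : k => a%:MP : P) (@pvar k I) (fun v => v \in t) f ->
  exists B, bounded B f.
Proof.
elim=> [a|v v_t|g h _ [B Bg] _ [C Ch]|g h _ [B Bg] _ [C Ch]].
- by exists 0%N; exact: boundedC.
- by exists 1%N; exact: boundedX.
- by exists (maxn B C); apply: boundedD; [apply: boundedS Bg|apply: boundedS Ch];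
    rewrite ?leq_maxl ?leq_maxr.
- by exists (B + C)%N; exact: boundedM.
Qed.

(** The monomials allowed by [bounded], indexed by a finite type in order to be
    counted. *)
Definition bounded_monom B (e : {ffun 'I_(size t) -> 'I_B.+1}) : {cmonom I} :=
  [cmonom (if insub (index v t) is Some i then e i : nat else 0%N) | v in seq_fset tt t]%M.

Lemma bounded_monomP B f m : bounded B f -> m \in msupp f ->
  exists e, m = bounded_monom (B := B) e.
Proof.
move=> Bf /Bf mB; exists [ffun i => inord (m (tnth (in_tuple t) i))].
apply/eqP/cmP => v; rewrite /bounded_monom cmE fsfun_fun seq_fsetE.
case: ifP => [v_t|v_t]; last by have := mB v; rewrite v_t leqn0 => /eqP.
case: insubP => [i _ Ei|]; last by rewrite index_mem v_t.
rewrite ffunE inordK; last first.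
  by rewrite ltnS; have := mB (tnth (in_tuple t) i); rewrite mem_tnth.
by rewrite (tnth_nth v) Ei nth_index.
Qed.
End Bounded.

Section Counting.
Local Open Scope fset_scope.
Local Open Scope ring_scope.
Variables (k : fieldType) (I J : choiceType).
Local Notation P := {malg k[{cmonom I}]}.
Local Notation Q := {malg k[{cmonom J}]}.

Lemma pvarX_monom (v : J) n : exists m : {cmonom J},
  pvar k v ^+ n = << m >> /\ forall w, m w = ((v == w) * n)%N.
Proof.
elim: n => [|n [m [Em mE]]].
  by exists mone; split=> // w; rewrite cm1 muln0.
exists (mmul (ucm v) m); rewrite exprS Em monomM; split=> // w.
by rewrite cmM ucmE mE mulnS.
Qed.

(** The exponents are stated as a sum so that repetitions in [s] are allowed.
    *)
Lemma pvar_prod_monom (s : seq J) (n : J -> nat) : exists m : {cmonom J},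
  \prod_(v <- s) pvar k v ^+ n v = << m >> /\
  forall w, m w = (\sum_(v <- s) (v == w) * n v)%N.
Proof.
elim: s => [|v s [m [Em mE]]].
  by exists mone; rewrite big_nil; split=> // w; rewrite cm1 big_nil.
have [m' [Em' mE']] := pvarX_monom v (n v).
exists (mmul m' m); rewrite big_cons Em Em' monomM; split=> // w.
by rewrite cmM mE mE' big_cons.
Qed.

(** There are (D + 1)^q monomials of exponents at most D in the unknowns, and
    their values have exponents at most q D d in M variables; for M < q the
    first count wins once D is large. *)
Lemma counting_bound (q M d D : nat) : (M < q)%N -> D = ((q * d).+1 ^ M)%N ->
  ((q * (D * d)).+1 ^ M < D.+1 ^ q)%N.
Proof.
move=> lt_Mq ED; apply: leq_trans (_ : (D.+1 ^ M.+1 <= _)%N); last first.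
  by rewrite leq_exp2l // ED ltnS expn_gt0.
apply: leq_ltn_trans (_ : (((q * d).+1 * D.+1) ^ M < _)%N).
  case: (M) => // M'; rewrite leq_exp2r //; nia.
by rewrite expnMn -ED expnS ltn_pmul2r // expn_gt0.
Qed.

(** The values of the monomials with exponents at most D in the [y v] lie in a
    space of smaller dimension than their number. *)
Theorem algebraic_counting_malg (y : J -> P) (s : seq J) (t : seq I) :
  uniq s -> (size t < size s)%N ->
  (forall v, v \in s -> gen (fun a : k => a%:MP : P) (@pvar k I) (fun w => w \in t) (y v)) ->
  exists2 h : Q, h != 0 & malg_eval (@mkmalgU {cmonom I} k mone) y h = 0.
Proof.
move=> us lt_ts gy.
have [d dy] : exists d, forall v, v \in s -> bounded t d (y v).
  elim: (s) gy => [|v s' IHs] gy; first by exists 0%N.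
  have [|d ds] := IHs; first by move=> w ws; apply: gy; rewrite in_cons ws orbT.
  have [B By] := gen_bounded (gy v (mem_head _ _)).
  exists (maxn B d) => w; rewrite in_cons => /orP [/eqP ->|/ds dw].
    by apply: (boundedS _ By); rewrite leq_maxl.
  by apply: (boundedS _ dw); rewrite leq_maxr.
(* The choice of [D] in [counting_bound]. *)
pose D := ((size s * d).+1 ^ size t)%N; pose B := (size s * (D * d))%N.
have lt_BD : (B.+1 ^ size t < D.+1 ^ size s)%N by exact: counting_bound.
pose exponent (e : {ffun 'I_(size s) -> 'I_D.+1}) v : nat :=
  if insub (index v s) is Some i then e i : nat else 0%N.
pose F e := \prod_(v <- s) y v ^+ exponent e v.
have bF e : bounded t B (F e).
  apply: bounded_prod => v vs.
  have dv : bounded t (exponent e v * d) (y v ^+ exponent e v).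
    by apply: boundedXn; exact: dy.
  apply: (boundedS _ dv).
  by rewrite leq_mul2r /exponent; case: insub => [i|]; rewrite ?orbT // -ltnS ltn_ord orbT.
have [mon monP] := fin_all_exists (fun e => pvar_prod_monom s (exponent e)).
have mon_s e (i : 'I_(size s)) : mon e (tnth (in_tuple s) i) = e i.
  have [_ ->] := monP e; set v := tnth _ i.
  have v_s : v \in s by rewrite mem_tnth.
  rewrite (bigD1_seq v) //= eqxx mul1n big1 ?addn0 => [|w /negbTE -> //].
  rewrite /exponent; have Ei : index v s = i.
    by rewrite /v (tnth_nth v) index_uniq.
  by rewrite Ei; case: insubP => [j _ /val_inj -> //|]; rewrite ltn_ord.
have mon_inj : injective mon.
  move=> e1 e2 E; apply/ffunP => i; apply: val_inj.
  by rewrite /= -!mon_s E.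
pose E' := {ffun 'I_(size t) -> 'I_B.+1}.
have [|x [e0 x0] Ex] := @nonzero_solution k {ffun 'I_(size s) -> 'I_D.+1} #|{: E'}|
  (fun e j => (F e)@_(bounded_monom (enum_val j : E'))).
  by rewrite !card_ffun !card_ord.
exists (\sum_e (x e)%:MP * \prod_(v <- s) pvar k v ^+ exponent e v).
  apply/eqP => /malgP /(_ (mon e0)); rewrite mcoeff0 raddf_sum => h0.
  move/eqP: x0; apply; rewrite -[RHS]h0.
  rewrite (eq_bigr (fun e => x e * (e == e0)%:R)) => [|e _]; last first.
    by rewrite [LHS]mcoeffCM (monP e).1 mcoeffU1 (inj_eq mon_inj).
  rewrite (bigD1 e0) //= eqxx mulr1 big1 ?addr0 // => e /negbTE ->.
  exact: mulr0.
have -> : malg_eval (@mkmalgU {cmonom I} k mone) y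
    (\sum_e (x e)%:MP * \prod_(v <- s) pvar k v ^+ exponent e v) = \sum_e (x e)%:MP * F e.
  rewrite rmorph_sum; apply: eq_bigr => e _; rewrite rmorphM /= malg_evalC rmorph_prod.
  by congr (_ * _); apply: eq_bigr => v _; rewrite rmorphXn /= malg_evalX.
apply/malgP => m; rewrite mcoeff0 raddf_sum /=.
case: (classic (exists e : E', m = bounded_monom e)) => [[e ->]|nom].
  rewrite -[RHS](Ex (enum_rank e)); apply: eq_bigr => e' _.
  by rewrite mcoeffCM enum_rankK.
rewrite big1 // => e _; rewrite mcoeffCM.
have [m_F|/mcoeff_outdom ->] := boolP (m \in msupp (F e)); last by rewrite mulr0.
by case: nom; exact: bounded_monomP (bF e) m_F.
Qed.
End Counting.

(** * Monomials of weight one *)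

Lemma delta_mul_split (R : comNzRingType) (a b d y z : R) :
  a * (y * d + z * b) = a * (z * b) + a * y * d.
Proof. by ring. Qed.

Lemma novikov_step (A : comNzRingType) (x y d t u : A) :
  u * (y * x) = x * (t * d + u * y) + - (t * x * d).
Proof. by ring. Qed.

Section NovikovMonomials.
Variables (k : fieldType) (n : nat).
Implicit Types (l c : seq ('I_n * nat)) (f g : dpoly k n).

Definition var_prod l : dpoly k n := \prod_(v <- l) dvar k v.1 v.2.
Definition weight l : int := \sum_(v <- l) var_weight v.

Lemma var_prod_cons v l : var_prod (v :: l) = dvar k v.1 v.2 * var_prod l.
Proof. exact: big_cons. Qed.

Lemma var_prod_cat l1 l2 : var_prod (l1 ++ l2) = var_prod l1 * var_prod l2.
Proof. exact: big_cat. Qed.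

Lemma var_prod1 v : var_prod [:: v] = dvar k v.1 v.2.
Proof. exact: big_seq1. Qed.

Lemma delta_var (i : 'I_n) r : delta (dvar k i r) = dvar k i r.+1.
Proof. exact: (der_var (fun v => dvar k v.1 v.2.+1) (i, r)). Qed.

Lemma deltaM f g : delta (f * g) = f * delta g + delta f * g.
Proof. exact: derM. Qed.

(** Multiplying by x_i' is [circ] with x_i. *)
Lemma novikov0_mul_ones f l : all (fun v => v.2 == 1%N) l -> novikov0 f ->
  novikov0 (f * var_prod l).
Proof.
elim: l f => [|[i r] l IHl] f; first by rewrite /var_prod big_nil mulr1.
case/andP => /= /eqP -> ones Nf; rewrite var_prod_cons mulrA.
apply: IHl => //; rewrite -[dvar k _ _]delta_var.
exact: novikov0_circ Nf (novikov0_var k i).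
Qed.

(** The derivative of the product over [c] is a sum over the factors of [c], so
    it is enough to treat each summand. *)
Lemma novikov0_mul_delta (pre c : seq ('I_n * nat)) :
  (forall c1 x c2, c = c1 ++ x :: c2 ->
    novikov0 (var_prod (pre ++ c1 ++ (x.1, x.2.+1) :: c2))) ->
  novikov0 (var_prod pre * delta (var_prod c)).
Proof.
elim: c pre => [|x c IHc] pre Hc.
  have -> : delta (var_prod [::]) = 0.
    by rewrite /var_prod big_nil -mpolyC1E; exact: derC.
  by rewrite mulr0; exact: novikov0_zero.
have -> : var_prod pre * delta (var_prod (x :: c)) =
    var_prod (pre ++ (x.1, x.2.+1) :: c) + var_prod (rcons pre x) * delta (var_prod c).
  rewrite -cats1 !var_prod_cat var_prod1 !var_prod_cons [delta _]deltaM delta_var.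
  exact: delta_mul_split.
apply: novikov0_add; first exact: (Hc [::] x c erefl).
apply: IHc => c1 y c2 Ec; rewrite cat_rcons.
by apply: (Hc (x :: c1)); rewrite Ec.
Qed.

Lemma perm_var_prod l1 l2 : perm_eq l1 l2 -> var_prod l1 = var_prod l2.
Proof. by move=> p; apply: perm_big. Qed.

Lemma perm_weight l1 l2 : perm_eq l1 l2 -> weight l1 = weight l2.
Proof. by move=> p; apply: perm_big. Qed.

Lemma weight_cat l1 l2 : weight (l1 ++ l2) = weight l1 + weight l2.
Proof. by rewrite /weight big_cat. Qed.

Lemma weight_cons v l : weight (v :: l) = var_weight v + weight l.
Proof. by rewrite /weight big_cons. Qed.

Lemma weight_zeros l : all (fun v => v.2 == 0%N) l -> weight l = (size l)%:Z.
Proof.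
elim: l => [|v l IHl] /=; first by rewrite /weight big_nil.
by case/andP => /eqP v0 /IHl; rewrite weight_cons /var_weight v0 => ->; lia.
Qed.

Lemma weight_nonzeros l : all (fun v => v.2 != 0%N) l -> (weight l <= 0)%R.
Proof.
elim: l => [|v l IHl] /=; first by rewrite /weight big_nil.
by case/andP => v0 /IHl; rewrite weight_cons /var_weight; lia.
Qed.

Lemma weight_ones l : all (fun v => v.2 == 1%N) l -> weight l = 0.
Proof.
elim: l => [|v l IHl] /=; first by rewrite /weight big_nil.
by case/andP => /eqP v0 /IHl; rewrite weight_cons /var_weight v0 => ->; lia.
Qed.

(** The sum of the squared orders decreases when an order s >= 2 is lowered to
    s - 1 and an order 0 is raised to 1. *)
Definition sumsq l : nat := (\sum_(v <- l) v.2 ^ 2)%N.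

(** Induction on the number of factors, then on [sumsq]. If a factor x^(s) with
    s >= 2 occurs, weight 1 forces at least s factors of order 0 to occur; let
    C be a product of s - 1 of them, and R the product of the other factors.
    Then R and x^(s-1) C have weight 1 and fewer factors, and R o (x^(s-1) C)
    is the given monomial plus terms R x^(s-1) C', where C' runs over the
    summands of the derivative of C; these have a smaller sum of squares. If
    all orders are at most 1, then exactly one is 0. *)
Lemma novikov0_var_prod l : weight l = 1 -> novikov0 (var_prod l).
Proof.
move: {-1}(size l) (leqnn (size l)) => T; elim: T l => [|T IHT] l.
  by rewrite leqn0 size_eq0 => /eqP ->; rewrite /weight big_nil.
move: {-1}(sumsq l) (leqnn (sumsq l)) => Q; elim/ltn_ind: Q l => Q IHQ l le_Q le_T wl.
have [/hasP [[b s] bs_l /= s_ge2]|] := boolP (has (fun v => 1 < v.2)%N l); last first.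
  rewrite -all_predC => /allP large; have small v : v \in l -> (v.2 <= 1)%N.
    by move=> /large /=; rewrite -leqNgt.
  pose Z := [seq v <- l | v.2 == 0%N]; pose U := [seq v <- l | v.2 != 0%N].
  have lZU : perm_eq l (Z ++ U) by rewrite perm_sym perm_filterC.
  have U1 : all (fun v => v.2 == 1%N) U.
    by apply/allP => v; rewrite mem_filter => /andP [v0 /small]; case: (v.2) v0 => [|[]].
  have Z0 : all (fun v => v.2 == 0%N) Z.
    by apply/allP => v; rewrite mem_filter => /andP [].
  have := wl; rewrite (perm_weight lZU) weight_cat weight_zeros // weight_ones // addr0.
  rewrite (perm_var_prod lZU); case: (Z) Z0 => [|[i r] [|]] //= /andP [/eqP -> _] _.
  rewrite var_prod_cons.
  exact: novikov0_mul_ones U1 (novikov0_var k i).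
have l_b : perm_eq l ((b, s) :: rem (b, s) l) by exact: perm_to_rem.
set l' := rem _ _ in l_b.
pose Z := [seq v <- l' | v.2 == 0%N]; pose U := [seq v <- l' | v.2 != 0%N].
have Z0 : all (fun v => v.2 == 0%N) Z.
  by apply/allP => v; rewrite mem_filter => /andP [].
have U0 : all (fun v => v.2 != 0%N) U.
  by apply/allP => v; rewrite mem_filter => /andP [].
have l'ZU : perm_eq l' (Z ++ U) by rewrite perm_sym perm_filterC.
have wl' : weight l' = s%:Z.
  by move: wl; rewrite (perm_weight l_b) weight_cons /var_weight /=; lia.
have sZ : (s <= size Z)%N.
  have wZ : weight Z = (size Z)%:Z by exact: weight_zeros.
  have := weight_nonzeros U0; move: wl'; rewrite (perm_weight l'ZU) weight_cat wZ.
  by lia.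
pose c := take s.-1 Z; pose R := drop s.-1 Z ++ U.
have c0 : all (fun v => v.2 == 0%N) c.
  by apply/allP => v /mem_take; move/allP: Z0; apply.
have sc : size c = s.-1 by rewrite size_take; case: ltnP => //; lia.
have l'cR : perm_eq l' (c ++ R) by rewrite catA cat_take_drop.
have wc : weight c = (s.-1)%:Z by rewrite weight_zeros // sc.
have wR : weight R = 1.
  by move: wl'; rewrite (perm_weight l'cR) weight_cat wc; lia.
have sl : size l = (s + size R)%N.
  by rewrite (perm_size l_b) /= (perm_size l'cR) size_cat sc -addSn prednK // ltnW.
have R0 : (0 < size R)%N.
  by case: (R) wR => //; rewrite /weight big_nil.
have le_sR : (s + size R <= T.+1)%N by rewrite -sl.
have NR : novikov0 (var_prod R).
  by apply: IHT wR; move: le_sR; move: (size R) => r; lia.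
have Ng : novikov0 (var_prod ((b, s.-1) :: c)).
  apply: IHT; last by rewrite weight_cons wc /var_weight /=; lia.
  by rewrite /= sc; move: le_sR R0; move: (size R) => r; lia.
have := novikov0_circ NR Ng; rewrite /circ.
have Nd : novikov0 (var_prod ((b, s.-1) :: R) * delta (var_prod c)).
  apply: novikov0_mul_delta => c1 x c2 Ec.
  have x0 : x.2 = 0%N by move/allP: c0 => /(_ x); rewrite Ec mem_cat mem_head orbT => /(_ isT) /eqP.
  have Es : perm_eq l ((b, s) :: (c1 ++ x :: c2) ++ R).
    by rewrite (perm_trans l_b) // perm_cons -Ec.
  have sq : (sumsq (((b, s.-1) :: R) ++ c1 ++ (x.1, x.2.+1) :: c2) < sumsq l)%N.
    have -> : sumsq l = sumsq ((b, s) :: (c1 ++ x :: c2) ++ R) by exact: perm_big.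
    rewrite /sumsq !(big_cons, big_cat) /= x0.
    by case: (s) s_ge2 => [|[|s']] //= _; lia.
  apply: (IHQ _ (leq_trans sq le_Q) _ (leqnn _)).
    by move: le_T; rewrite (perm_size Es) /= !size_cat /=; lia.
  move: wl; rewrite (perm_weight Es) !(weight_cons, weight_cat) /var_weight /= x0.
  by case: (s) s_ge2 => [|s'] //= _; lia.
move=> Nc; have NN := novikov0_add Nc (novikov0_scale (-1) Nd).
suff -> : var_prod l = var_prod R * delta (var_prod ((b, s.-1) :: c)) +
  -1 *: (var_prod ((b, s.-1) :: R) * delta (var_prod c)) by [].
rewrite (perm_var_prod l_b) var_prod_cons (perm_var_prod l'cR) var_prod_cat.
rewrite !var_prod_cons [delta (_ * _)]deltaM delta_var scaleN1r prednK; last lia.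
exact: novikov_step.
Qed.
End NovikovMonomials.

(** * Homogeneous components *)

Lemma euler_step (A : comNzRingType) (x f e : A) (w1 w2 : int) :
  e = w2%:~R * f ->
  x * e + (w1%:~R * x) * f = (w1 + w2)%:~R * (x * f).
Proof. by move=> ->; rewrite rmorphD /=; ring. Qed.

Definition dpoly_alg (k : fieldType) (char0 : [pchar k] =i pred0) (n : nat) :
  polyAlg k ('I_n * nat)%type := malg_polyAlg ('I_n * nat)%type char0.

Section Weights.
Local Open Scope fset_scope.
Local Open Scope ring_scope.
Variables (k : fieldType) (char0 : [pchar k] =i pred0) (n : nat).
Local Notation M := (dpoly_alg char0 n).
Local Notation homogeneous := (homogeneous (P := dpoly_alg char0) (n := n)).
Implicit Types (m : dmonom n) (f g h : dpoly k n).

Definition mweight m : int :=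
  \sum_(v <- finsupp (cmonom_val m)) var_weight v *+ m v.

Lemma mweightEw (d : {fset 'I_n * nat}) m : finsupp (cmonom_val m) `<=` d ->
  mweight m = \sum_(v <- d) var_weight v *+ m v.
Proof.
move=> le; rewrite /mweight (big_fset_incl _ le) // => v _.
by rewrite -cmE_neq0 negbK => /eqP ->.
Qed.

Lemma mweightX (v : 'I_n * nat) m : mweight (mmul (ucm v) m) = var_weight v + mweight m.
Proof.
have le := fsubsetUr [fset v] (finsupp (cmonom_val m)).
have v_d : v \in [fset v] `|` finsupp (cmonom_val m) by rewrite !inE eqxx.
rewrite {1}/mweight mdomD mdomU (mweightEw le).
rewrite (eq_bigr (fun w => var_weight w *+ (v == w) + var_weight w *+ m w)).
  rewrite big_split /= (big_fsetD1 v v_d) /= eqxx mulr1n big1_fset ?addr0 //.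
  by move=> w; rewrite in_fsetD1 eq_sym => /andP [/negbTE -> _] _.
by move=> w _; rewrite cmM ucmE mulrnDr.
Qed.

Lemma monom_var_prod m : exists2 l, << m >> = var_prod k l & weight l = mweight m.
Proof.
move: m; apply: monom_rect_prop => [|v m [l El wl]].
  exists [::]; first by rewrite /var_prod big_nil.
  by rewrite /weight big_nil /mweight mdom1 big_seq_fset0.
exists (v :: l); last by rewrite weight_cons mweightX wl.
by rewrite monomM El var_prod_cons; case: v.
Qed.

Definition eulerM : dpoly k n -> dpoly k n :=
  der (fun v => (var_weight v)%:~R * pvar k v).

Lemma euler_monom m : eulerM << m >> = (mweight m)%:~R * << m >>.
Proof.
move: m; apply: monom_rect_prop => [|v m Em].
  rewrite /mweight mdom1 big_seq_fset0 [RHS]mul0r; exact: derC.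
rewrite mweightX monomM /eulerM.
apply: etrans (derX _ v << m >>) _; exact: euler_step.
Qed.

Lemma int_malg (w : int) : w%:~R = (w%:~R)%:MP :> dpoly k n.
Proof. by rewrite rmorph_int. Qed.

(** The Euler operator acts on monomials through their weights, so homogeneity
    is a condition on the support. *)
Lemma mcoeff_euler f m : (eulerM f)@_m = (mweight m)%:~R * f@_m.
Proof.
pose Q h := (eulerM h)@_m = (mweight m)%:~R * h@_m.
apply: (@poly_lin_ind _ _ Q); rewrite /Q {Q}.
- by rewrite /eulerM der0 !mcoeff0 mulr0.
- move=> f1 f2 E1 E2; apply: etrans (congr1 (mcoeff m) (derD _ f1 f2)) _.
  apply: etrans (mcoeffD _ _ _) _; apply: etrans (congr2 +%R E1 E2) _.
  by rewrite mcoeffD mulrDr.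
- move=> a f1 E1; apply: etrans (congr1 (mcoeff m) (derZ _ a f1)) _.
  apply: etrans (mcoeffZ _ _ _) _; apply: etrans (congr1 ( *%R a) E1) _.
  by rewrite mcoeffZ mulrCA.
- move=> m0 _; rewrite euler_monom int_malg mcoeffCM mcoeffU1.
  by case: eqP => [->|_]; rewrite ?mulr0.
Qed.

Lemma homogeneous_mweight w (f : M) : homogeneous w f ->
  forall m, m \in msupp f -> mweight m = w.
Proof.
move=> hf m; rewrite -mcoeff_neq0 => fm.
have : (eulerM f)@_m = w%:~R * f@_m.
  have -> : eulerM f = w%:~R * f by exact: hf.
  by rewrite int_malg mcoeffCM.
rewrite mcoeff_euler => E.
apply/eqP; rewrite -subr_eq0; apply/eqP/(intr_eq0_char0 char0)/eqP.
by rewrite rmorphB subr_eq0; apply/eqP/(mulIf fm).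
Qed.

Lemma mweight_homogeneous w (f : M) :
  (forall m, m \in msupp f -> mweight m = w) -> homogeneous w f.
Proof.
move=> fw; suff : eulerM f = w%:~R * f by [].
apply/malgP => m; rewrite mcoeff_euler int_malg mcoeffCM.
by case: msuppP => [/fw -> //|_]; rewrite !mulr0.
Qed.

Lemma homogeneous1_novikov0 (f : M) : homogeneous 1 f -> novikov0 (f : dpoly k n).
Proof.
move=> /homogeneous_mweight fw; rewrite [f : dpoly k n](monalgE f) big_seq.
elim/big_rec: _ => [|m g m_f Ng]; first exact: novikov0_zero.
apply: novikov0_add => //; rewrite monomZ; apply: novikov0_scale.
have [l -> wl] := monom_var_prod m.
by apply: novikov0_var_prod; rewrite wl fw.
Qed.

Definition component w f : dpoly k n :=
  [malg m in msupp f => if mweight m == w then f@_m else 0].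

Lemma mcoeff_component w f m :
  (component w f)@_m = if mweight m == w then f@_m else 0.
Proof.
rewrite /component mcoeffE; case: ifP => // m_f.
by rewrite mcoeff_outdom ?m_f //; case: ifP.
Qed.

Lemma homogeneous_decomposition (f : M) : f != 0 -> exists s : seq (int * M),
  [/\ s != [::], uniq (map fst s),
   forall x, x \in s -> x.2 != 0 /\ homogeneous x.1 x.2
   & \sum_(x <- s) x.2 = f].
Proof.
move=> f0; pose W := undup (map mweight (msupp (f : dpoly k n))).
exists [seq (w, component w f : M) | w <- W]; split.
- rewrite -size_eq0 size_map size_eq0 -size_eq0.
  have [m m_f] : exists m, m \in msupp (f : dpoly k n).
    by apply/fset0Pn; rewrite msupp_eq0.
  have : mweight m \in W by rewrite mem_undup; apply: map_f.
  by case: (W).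
- by rewrite -map_comp map_id undup_uniq.
- move=> _ /mapP [w wW ->] /=; split.
    move: wW; rewrite mem_undup => /mapP [m m_f Ew].
    apply/eqP => /malgP /(_ m); rewrite mcoeff_component Ew eqxx mcoeff0 => /eqP.
    by rewrite mcoeff_eq0 m_f.
  apply: mweight_homogeneous => m; rewrite -mcoeff_neq0 mcoeff_component.
  by case: (mweight m =P w) => // _; rewrite eqxx.
rewrite big_map /=; apply/malgP => m; rewrite raddf_sum /=.
rewrite (eq_bigr (fun w => if mweight m == w then f@_m else 0)); last first.
  by move=> w _; rewrite mcoeff_component.
have [m_f|m_f] := msuppP f m; last first.
  by rewrite big1 // => w _; case: ifP.
rewrite (bigD1_seq (mweight m)) ?undup_uniq ?mem_undup ?map_f //=.
rewrite [X in if X then _ else _]eqxx big1 ?addr0 //.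
by move=> w; rewrite eq_sym => /negbTE ->.
Qed.

End Weights.

(** * Novikov dependence and differential algebraic dependence *)

Section NovikovDependence.
Variables (k : fieldType) (char0 : [pchar k] =i pred0).
Local Notation M := (dpoly_alg char0).

Lemma homogeneous_var n (v : 'I_n * nat) :
  homogeneous (P := M) (var_weight v) (pX v).
Proof. exact: pderX. Qed.

Lemma homogeneousX n w (f : M n) e :
  homogeneous (P := M) w f -> homogeneous (P := M) (w *+ e) (f ^+ e).
Proof.
move=> hf; elim: e => [|e IHe].
  have d1 := derivationC (euler_derivation M n) 1.
  by rewrite rmorph1 in d1; rewrite /homogeneous d1 mul0r.
by rewrite mulrS exprS; apply: homogeneousM.
Qed.

Lemma pX_neq0 n (v : 'I_n * nat) : (pX v : M n) != 0.
Proof.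
apply/eqP => /(congr1 (point_eval (M n) (fun=> 1))); rewrite point_evalX rmorph0 => /eqP.
by rewrite oner_eq0.
Qed.

Lemma pexpr_neq0 n (f : M n) e : f != 0 -> f ^+ e != 0.
Proof.
move=> f0; elim: e => [|e IHe]; first exact: oner_neq0.
by rewrite exprS; exact: pmulf_neq0.
Qed.

(** A derivative x_i^(r) has weight 1 - r, which reaches all weights up to 1;
    powers of x_i reach the others. *)
Lemma homogeneous_multiplier n (i : 'I_n) (w : int) :
  exists2 f : M n, f != 0 & homogeneous (P := M) (1 - w) f.
Proof.
case: w => r.
  by exists (pX (i, r)); [exact: pX_neq0 | exact: homogeneous_var].
exists (pX (i, 0%N) ^+ r.+2); first exact/pexpr_neq0/pX_neq0.
have -> : 1 - Negz r = var_weight (i, 0%N) *+ r.+2.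
  by rewrite /var_weight /= subr0 NegzE opprK natz -intS.
exact/homogeneousX/homogeneous_var.
Qed.

Lemma novikov0_novikov n (f : dpoly k n) : novikov0 f -> novikov f.
Proof.
move=> Nf; exists 0, f; split=> //; rewrite malgC0E; symmetry; exact: add0r.
Qed.

(** The homogeneous relation obtained from any relation is multiplied up to
    weight 1, where it lies in N_0. *)
Theorem novikov_dependentP p n (f : 'I_p -> dpoly k n) :
  novikov_dependent f <-> dependent (P := M) f.
Proof.
split=> [[h [_ h0 Rh]]|[h h0 Rh]]; first by exists h.
have [i _] := relation_leading (P := M) h0 Rh.
have [s [s0 us hs Es]] := homogeneous_decomposition h0.
have [|w [g [g0 hg Rg]]] := homogeneous_relation char0 s0 us hs (G := f : _ -> M n).
  by rewrite Es.
have [e e0 he] := homogeneous_multiplier i w.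
have N1 : novikov0 (g * e : M p).
  apply: (homogeneous1_novikov0 (char0 := char0)); rewrite -(subrKC w 1).
  exact: homogeneousM hg he.
have R1 : dsub (P := M) f (g * e) = 0 by rewrite rmorphM Rg mul0r.
exact: (ex_intro _ (g * e : M p)
  (And3 (novikov0_novikov N1) (pmulf_neq0 char0 g0 e0) R1)).
Qed.

Lemma algebraic_counting_dpoly : algebraic_counting M.
Proof. by move=> q n y s t; exact: algebraic_counting_malg. Qed.

(** The elements [J] are arbitrary rather than variables, so that checking a
    certificate does not involve recognizing variables. *)
Theorem independence_certificate n (F : seq (M n)) :
  ~ dependent (P := M) (nthf F (q := size F)) <->
  exists J : seq (M n), let G := F ++ J in
    (size G <= n)%N /\ forall j : 'I_n, exists (p : M (size G).+1) r,
      let x := rcons G (pX (j, 0%N)) in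
      dsub (nthf x (q := (size G).+1)) p = 0 /\
      dsub (nthf x (q := (size G).+1)) (pdiff (ord_max, r) p) != 0.
Proof.
split=> [|[J [le_n pP]]].
  move=> /(certificate_exists algebraic_counting_dpoly) [J HJ].
  by exists [seq pX (j, 0%N) | j <- J].
have [p {}pP] := fin_all_exists pP; have [r {}pP] := fin_all_exists pP.
have ext j : extend (nthf (F ++ J) (q := size (F ++ J))) (pX (j, 0%N)) =1
    nthf (rcons (F ++ J) (pX (j, 0%N))) (q := (size (F ++ J)).+1).
  by move=> i; exact: extend_nthf.
have indG : ~ dependent (P := M) (nthf (F ++ J) (q := size (F ++ J))).
  apply: (@certificate_sound _ char0 M _ _ (nthf (F ++ J) (q := _)) p r le_n) => j.
    by rewrite (dsub_ext _ (ext j)); exact: (pP j).1.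
  by rewrite (dsub_ext _ (ext j)); exact: (pP j).2.
move=> depF; apply: indG.
have le_F : (size F <= size (F ++ J))%N by rewrite size_cat leq_addr.
apply: (dependent_sub (s := widen_ord le_F)); first by move=> i j /(congr1 val) /= /val_inj.
apply: dependent_ext depF => i.
by rewrite /nthf /= nth_cat ltn_ord.
Qed.

(** The same with the sizes as separate numbers, since the algebra of the [p]
    depends on them. *)
Lemma independence_certificate_size n q0 (F : seq (M n)) : size F = q0 ->
  (exists J q, [/\ size (F ++ J) = q, (q <= n)%N &
    forall j : 'I_n, exists (p : M q.+1) r,
      dsub (nthf (P := M) (rcons (F ++ J) (pX (j, 0%N))) (q := q.+1)) p = 0 /\
      dsub (nthf (P := M) (rcons (F ++ J) (pX (j, 0%N))) (q := q.+1))
        (pdiff (ord_max, r) p) != 0])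
  <-> ~ dependent (P := M) (nthf F (q := q0)).
Proof.
move=> <-; apply: iff_trans (iff_sym (independence_certificate F)); split.
  by case=> J [_ [<- le_n pP]]; exists J; split.
by case=> J [le_n pP]; exists J, (size (F ++ J)); split.
Qed.
End NovikovDependence.

(** * Recursive functions of tuples *)
Local Close Scope ring_scope.

Lemma recursive_ext m (f g : m.-tuple nat -> nat) :
  recursive f -> f =1 g -> recursive g.
Proof.
move=> rf fg.
apply: (rec_comp (g := fun i v => tnth v i) rf) => [i|v]; first exact: rec_proj.
by rewrite -fg; congr f; apply: eq_from_tnth => i; rewrite tnth_mktuple.
Qed.

Lemma recursive_nth m i : recursive (fun v : m.-tuple nat => nth 0 v i).
Proof.
case: (ltnP i m) => [lt_im|le_mi].
  by apply: (rec_proj (i := Ordinal lt_im)) => v; rewrite (tnth_nth 0).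
by apply: rec_zero => v; rewrite nth_default ?size_tuple.
Qed.

Lemma recursive_comp1 m (f : 1.-tuple nat -> nat) (g : m.-tuple nat -> nat) :
  recursive f -> recursive g -> recursive (fun v => f [tuple g v]).
Proof.
move=> rf rg; apply: (rec_comp (g := fun=> g) rf) => // v.
by congr f; apply: eq_from_tnth => i; rewrite tnth_mktuple (ord1 i).
Qed.

Lemma recursive_comp2 m (f : 2.-tuple nat -> nat) (g1 g2 : m.-tuple nat -> nat) :
  recursive f -> recursive g1 -> recursive g2 ->
  recursive (fun v => f [tuple g1 v; g2 v]).
Proof.
move=> rf rg1 rg2.
apply: (rec_comp (g := fun i : 'I_2 => if i == ord0 then g1 else g2) rf) => [i|v].
  by case: ifP.
congr f; apply: eq_from_tnth => i; rewrite tnth_mktuple (tnth_nth 0).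
by case: i => [[|[|]]].
Qed.

Lemma recursive_succ m (f : m.-tuple nat -> nat) :
  recursive f -> recursive (fun v => (f v).+1).
Proof.
have rS : recursive (fun v : 1.-tuple nat => (nth 0 v 0).+1).
  by apply: rec_succ => v; rewrite (tnth_nth 0).
by move=> rf; have := recursive_comp1 rS rf.
Qed.

Lemma recursive_const m c : recursive (fun _ : m.-tuple nat => c).
Proof.
by elim: c => [|c IHc]; [exact: rec_zero | exact: recursive_succ].
Qed.

Lemma recursive_iter m (F N : m.-tuple nat -> nat) (G : m.+2.-tuple nat -> nat) :
  recursive F -> recursive G -> recursive N ->
  recursive (fun v => nat_rect (fun=> nat) (F v)
    (fun i a => G [tuple of i :: [tuple of a :: v]]) (N v)).
Proof.
move=> rF rG rN.
pose H (w : m.+1.-tuple nat) := nat_rect (fun=> nat) (F [tuple of behead w])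
    (fun i a => G [tuple of i :: [tuple of a :: [tuple of behead w]]]) (thead w).
have behead_cons a (v : m.-tuple nat) : [tuple of behead [tuple of a :: v]] = v.
  exact: val_inj.
have rH : recursive H.
  by apply: (rec_prim rF rG) => [v|i v]; rewrite /H !theadE !behead_cons.
apply: (rec_comp (l := m.+1)
  (g := fun i v => tnth [tuple of N v :: v] i) rH) => [i|v].
  case: (unliftP ord0 i) => [j|] ->.
    by apply: (rec_proj (i := j)) => v; rewrite tnthS.
  by apply: recursive_ext rN _ => v; rewrite tnth0.
have -> : [tuple tnth [tuple of N v :: v] i  | i < m.+1] = [tuple of N v :: v].
  by apply: eq_from_tnth => i; rewrite tnth_mktuple.
by rewrite /H theadE behead_cons.
Qed.

Lemma recursive_iter1 (F : 1.-tuple nat -> nat) (N : 1.-tuple nat -> nat)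
    (G : nat -> nat -> nat -> nat) :
  recursive F -> recursive (fun w : 3.-tuple nat => G (nth 0 w 0) (nth 0 w 1) (nth 0 w 2)) ->
  recursive N ->
  recursive (fun v => nat_rect (fun=> nat) (F v)
    (fun i a => G i a (nth 0 v 0)) (N v)).
Proof. by move=> rF rG rN; exact: (recursive_iter rF rG rN). Qed.

Section Arithmetic.
Variable m : nat.
Implicit Types f g h : m.-tuple nat -> nat.

Lemma recursive_add f g :
  recursive f -> recursive g -> recursive (fun v => f v + g v).
Proof.
move=> rf rg; apply: recursive_ext (recursive_iter rf
  (recursive_succ (recursive_nth m.+2 1)) rg) _ => v /=.
by elim: (g v) => [|n /= ->]; rewrite ?addn0 ?addnS.
Qed.

Lemma recursive_pred f : recursive f -> recursive (fun v => (f v).-1).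
Proof.
move=> rf; apply: recursive_ext (recursive_iter (recursive_const m 0)
  (recursive_nth m.+2 0) rf) _ => v /=.
by case: (f v).
Qed.
End Arithmetic.

Lemma recursive_sub m (f g : m.-tuple nat -> nat) :
  recursive f -> recursive g -> recursive (fun v => f v - g v).
Proof.
move=> rf rg; apply: recursive_ext (recursive_iter rf
  (recursive_pred (recursive_nth m.+2 1)) rg) _ => v /=.
by elim: (g v) => [|n /= ->]; rewrite ?subn0 ?subnS.
Qed.

Lemma recursive_mul m (f g : m.-tuple nat -> nat) :
  recursive f -> recursive g -> recursive (fun v => f v * g v).
Proof.
move=> rf rg.
have r2 : recursive (fun v : 2.-tuple nat => nth 0 v 0 * nth 0 v 1).
  apply: recursive_ext (recursive_iter (recursive_const 2 0)
    (recursive_add (recursive_nth 4 1) (recursive_nth 4 2))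
    (recursive_nth 2 1)) _ => v /=.
  by elim: (nth 0 v 1) => [|n /= ->]; rewrite ?muln0 // mulnS addnC.
exact: (recursive_comp2 r2 rf rg).
Qed.

Lemma recursive_exp2 m (f : m.-tuple nat -> nat) :
  recursive f -> recursive (fun v => 2 ^ f v).
Proof.
move=> rf; apply: recursive_ext (recursive_iter (recursive_const m 1)
  (recursive_add (recursive_nth m.+2 1) (recursive_nth m.+2 1)) rf) _ => v /=.
by elim: (f v) => [//|n /= ->]; rewrite addnn expnS mul2n.
Qed.

Lemma recursive_eq0 m (f : m.-tuple nat -> nat) :
  recursive f -> recursive (fun v => f v == 0).
Proof.
move=> rf; apply: recursive_ext (recursive_sub (recursive_const m 1) rf) _ => v.
by case: (f v).
Qed.

Lemma recursive_odd m (f : m.-tuple nat -> nat) :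
  recursive f -> recursive (fun v => odd (f v)).
Proof.
move=> rf; apply: recursive_ext (recursive_iter (recursive_const m 0)
  (recursive_eq0 (recursive_nth m.+2 1)) rf) _ => v /=.
by elim: (f v) => [//|n /= ->]; case: odd.
Qed.

Lemma recursive_half m (f : m.-tuple nat -> nat) :
  recursive f -> recursive (fun v => (f v)./2).
Proof.
move=> rf.
have r1 : recursive (fun v : 1.-tuple nat => (nth 0 v 0)./2).
  apply: recursive_ext (recursive_iter (recursive_const 1 0)
    (recursive_add (recursive_odd (recursive_nth 3 0)) (recursive_nth 3 1))
    (recursive_nth 1 0)) _ => v /=.
  elim: (nth 0 v 0) => [//|n /= ->]; rewrite uphalf_half //.
exact: (recursive_comp1 r1 rf).
Qed.

(** The code of a :: s in terms of the codes of a and s.  Its 2-adic valuation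
    is the head, and the rest of its binary expansion gives the tail. *)
Definition code_cons (a c : nat) := 2 ^ a * c.*2.+1.
Definition code_head (c : nat) := head 0 (CodeSeq.decode c).
Definition code_tail (c : nat) := CodeSeq.code (behead (CodeSeq.decode c)).

Lemma code_eta c : c = 0 \/ c = code_cons (code_head c) (code_tail c).
Proof.
rewrite /code_head /code_tail; case E: (CodeSeq.decode c) => [|a s].
  by left; rewrite -[c]CodeSeq.decodeK E.
by right; rewrite -[LHS]CodeSeq.decodeK E.
Qed.

Lemma code_cons_eq0 a c : (code_cons a c == 0) = false.
Proof. by apply/negbTE; rewrite -lt0n muln_gt0 expn_gt0. Qed.

Lemma recursive_code_cons m (f g : m.-tuple nat -> nat) :
  recursive f -> recursive g -> recursive (fun v => code_cons (f v) (g v)).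
Proof.
move=> rf rg; apply: recursive_mul (recursive_exp2 rf) (recursive_succ _).
by apply: recursive_ext (recursive_add rg rg) _ => v; rewrite addnn.
Qed.

Lemma iter_half_cons i a c :
  i <= a -> iter i half (code_cons a c) = 2 ^ (a - i) * c.*2.+1.
Proof.
elim: i => [|i IHi] le_ia; first by rewrite subn0.
rewrite iterS IHi; last exact: ltnW.
by rewrite -[a - i]prednK ?subn_gt0 // -subnS expnS -mulnA mul2n doubleK.
Qed.

Lemma recursive_iter_half m (f g : m.-tuple nat -> nat) :
  recursive f -> recursive g -> recursive (fun v => iter (f v) half (g v)).
Proof.
move=> rf rg; apply: recursive_ext (recursive_iter rg
  (recursive_half (recursive_nth m.+2 1)) rf) _ => v /=.
by elim: (f v) => [//|n /= ->].
Qed.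

Lemma recursive_code_head m (f : m.-tuple nat -> nat) :
  recursive f -> recursive (fun v => code_head (f v)).
Proof.
move=> rf.
have r1 : recursive (fun v : 1.-tuple nat => code_head (nth 0 v 0)).
  pose T (w : 2.-tuple nat) : nat :=
    odd (iter (nth 0 w 0) half (nth 0 w 1)) + (nth 0 w 1 == 0) == 0.
  have rT : recursive T.
    apply: recursive_eq0; apply: recursive_add.
      apply: recursive_odd.
      exact: recursive_iter_half (recursive_nth _ 0) (recursive_nth _ 1).
    exact: recursive_eq0 (recursive_nth _ 1).
  apply: rec_min rT _ => v; rewrite /T; set c := nth 0 v 0.
  have -> : nth 0 [tuple of code_head c :: v] 1 = c by [].
  have [->//|Ec] := code_eta c; split=> [|i lt_ia].
    rewrite [in X in _ + X]Ec code_cons_eq0 /= {2}Ec iter_half_cons //.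
    by rewrite subnn mul1n oddS odd_double.
  have -> : nth 0 [tuple of i :: v] 1 = c by [].
  rewrite [in X in _ + X]Ec code_cons_eq0 /= Ec iter_half_cons 1?ltnW //.
  rewrite -[code_head c - i]prednK ?subn_gt0 // expnS -mulnA mul2n.
  by rewrite odd_double.
exact: (recursive_comp1 r1 rf).
Qed.

Lemma recursive_code_tail m (f : m.-tuple nat -> nat) :
  recursive f -> recursive (fun v => code_tail (f v)).
Proof.
move=> rf; apply: recursive_ext (recursive_half (recursive_iter_half
  (recursive_code_head rf) rf)) _ => v.
have [Ec|Ec] := code_eta (f v); first by rewrite /= Ec.
by rewrite {2}Ec iter_half_cons // subnn mul1n /= uphalf_double.
Qed.

(** * Computable functions on coded types *)

(** A pair or a list is coded by [CodeSeq.code] of the list of codes, as in the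
    numbering of systems of presentations. *)
Class coded (T : Type) := Coded { enc : T -> nat; enc_inj : injective enc }.

#[global] Instance coded_nat : coded nat := Coded (@inj_id nat).
Lemma nat_of_bool_inj : injective nat_of_bool. Proof. by do 2 case. Qed.
#[global] Instance coded_bool : coded bool := Coded nat_of_bool_inj.

Definition enc_pair A B (cA : coded A) (cB : coded B) (x : A * B) :=
  CodeSeq.code [:: enc x.1; enc x.2].
Lemma enc_pair_inj A B (cA : coded A) (cB : coded B) : injective (enc_pair cA cB).
Proof.
move=> [a b] [a' b'] /(can_inj CodeSeq.codeK) [Ea Eb].
by rewrite (enc_inj Ea) (enc_inj Eb).
Qed.
#[global] Instance coded_pair A B (cA : coded A) (cB : coded B) : coded (A * B) :=
  Coded (@enc_pair_inj A B cA cB).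

Definition enc_seq A (cA : coded A) (s : seq A) := CodeSeq.code (map enc s).
Lemma enc_seq_inj A (cA : coded A) : injective (enc_seq cA).
Proof.
by move=> s t /(can_inj CodeSeq.codeK); apply: inj_map; apply: enc_inj.
Qed.
#[global] Instance coded_seq A (cA : coded A) : coded (seq A) :=
  Coded (@enc_seq_inj A cA).

(** Only the values on codes are prescribed. Several arguments are passed as
    nested pairs. *)
Definition computable A B {cA : coded A} {cB : coded B} (f : A -> B) : Prop :=
  exists2 g : nat -> nat,
    recursive (fun v : 1.-tuple nat => g (nth 0 v 0)) &
    forall a, g (enc a) = enc (f a).

Section Closure.
Context {A B C : Type} {cA : coded A} {cB : coded B} {cC : coded C}.

Lemma computable_ext (f g : A -> B) :
  computable f -> f =1 g -> computable g.
Proof. by move=> [h rh hE] fg; exists h => // a; rewrite hE fg. Qed.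

Lemma computable_id : computable (fun x : A => x).
Proof. by exists id => //; apply: recursive_nth. Qed.

Lemma computable_const (c : B) : computable (fun _ : A => c).
Proof. by exists (fun=> enc c) => //; apply: recursive_const. Qed.

Lemma computable_comp (g : B -> C) (f : A -> B) :
  computable g -> computable f -> computable (fun x => g (f x)).
Proof.
move=> [g' rg gE] [f' rf fE]; exists (fun c => g' (f' c)) => [|a].
  exact: (recursive_comp1 rg rf).
by rewrite fE gE.
Qed.

Lemma computable_pair (f : A -> B) (g : A -> C) :
  computable f -> computable g -> computable (fun x => (f x, g x)).
Proof.
move=> [f' rf fE] [g' rg gE].
exists (fun c => code_cons (f' c) (code_cons (g' c) 0)) => [|a].
  apply: recursive_code_cons => //; apply: recursive_code_cons => //.
  exact: recursive_const.
by rewrite fE gE.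
Qed.

Lemma computable_fst (f : A -> B * C) :
  computable f -> computable (fun x => (f x).1).
Proof.
move=> [f' rf fE]; exists (fun c => code_head (f' c)) => [|a].
  exact: recursive_code_head.
by rewrite fE /code_head CodeSeq.codeK.
Qed.

Lemma computable_snd (f : A -> B * C) :
  computable f -> computable (fun x => (f x).2).
Proof.
move=> [f' rf fE]; exists (fun c => code_head (code_tail (f' c))) => [|a].
  exact/recursive_code_head/recursive_code_tail.
by rewrite fE /code_head /code_tail !CodeSeq.codeK.
Qed.

Lemma computable_nat_rect (z : A -> B) (N : A -> nat) (s : A -> nat -> B -> B) :
  computable z -> computable N ->
  computable (fun y : A * (nat * B) => s y.1 y.2.1 y.2.2) ->
  computable (fun x => nat_rect (fun=> B) (z x) (s x) (N x)).
Proof.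
move=> [z' rz zE] [N' rN NE] [s' rs sE].
exists (fun c => nat_rect (fun=> nat) (z' c) (fun i a =>
  s' (code_cons c (code_cons (code_cons i (code_cons a 0)) 0))) (N' c)) => [|a].
  apply: (recursive_iter1 (G := fun i a c =>
    s' (code_cons c (code_cons (code_cons i (code_cons a 0)) 0)))) => //.
  apply: (recursive_comp1 rs).
  by do ! [apply: recursive_code_cons | apply: recursive_nth
         | apply: recursive_const].
rewrite NE zE /enc /=; elim: (N a) => [//|n IHn] /=.
by rewrite {}IHn; have /= := sE (a, (n, nat_rect (fun=> B) (z a) (s a) n)).
Qed.

Lemma computable_if (b : A -> bool) (f g : A -> B) :
  computable b -> computable f -> computable g ->
  computable (fun x => if b x then f x else g x).
Proof.
move=> [b' rb bE] [f' rf fE] [g' rg gE].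
exists (fun c => b' c * f' c + (1 - b' c) * g' c) => [|a].
  apply: recursive_add; apply: recursive_mul => //.
  exact: recursive_sub (recursive_const 1 1) _.
rewrite bE fE gE /enc /=; case: (b a); rewrite /= ?mul1n ?mul0n ?addn0 //.
Qed.

Lemma computable_cons (f : A -> B) (s : A -> seq B) :
  computable f -> computable s -> computable (fun x => f x :: s x).
Proof.
move=> [f' rf fE] [s' rs sE].
exists (fun c => code_cons (f' c) (s' c)) => [|a].
  exact: recursive_code_cons.
by rewrite fE sE.
Qed.

Lemma computable_case_seq (s : A -> seq B) (z : A -> C) (f : A -> B -> seq B -> C) :
  computable s -> computable z ->
  computable (fun y : A * (B * seq B) => f y.1 y.2.1 y.2.2) ->
  computable (fun x => match s x with [::] => z x | b :: t => f x b t end).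
Proof.
move=> [s' rs sE] [z' rz zE] [f' rf fE].
pose F c := f' (code_cons c (code_cons
  (code_cons (code_head (s' c)) (code_cons (code_tail (s' c)) 0)) 0)).
exists (fun c => (s' c == 0) * z' c + (1 - (s' c == 0)) * F c) => [|a].
  have req := recursive_eq0 rs.
  apply: recursive_add; apply: recursive_mul => //.
    exact: recursive_sub (recursive_const 1 1) _.
  apply: (recursive_comp1 rf).
  do ! [apply: recursive_code_cons | apply: recursive_nth
         | apply: recursive_const].
    exact: recursive_code_head.
  exact: recursive_code_tail.
rewrite zE sE /F; rewrite {1 2}/enc /= /enc_seq.
case Es: (s a) => [|b t].
  by rewrite /= mul1n mul0n addn0.
have -> : (CodeSeq.code [seq enc i | i <- b :: t] == 0) = false.
  by apply/negbTE; rewrite -lt0n muln_gt0 expn_gt0.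
rewrite mul0n mul1n add0n -(fE (a, (b, t))) sE Es.
by rewrite /code_head /code_tail {2 3}/enc /= /enc_seq !CodeSeq.codeK.
Qed.

End Closure.

Local Open Scope ring_scope.

(** * Computable list functions and search *)
Local Close Scope ring_scope.

Section Lists.
Context {A B C : Type} {cA : coded A} {cB : coded B} {cC : coded C}.

Lemma computable_op2 D {cD : coded D} (op : B -> C -> D) (f : A -> B) (g : A -> C) :
  computable (fun x : B * C => op x.1 x.2) ->
  computable f -> computable g -> computable (fun x => op (f x) (g x)).
Proof.
move=> cop cf cg.
exact: (computable_comp cop (computable_pair cf cg)).
Qed.

Lemma computable_behead (s : A -> seq B) :
  computable s -> computable (fun x => behead (s x)).
Proof.
move=> cs; apply: computable_ext (computable_case_seq (f := fun _ _ t => t)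
  cs (computable_const [::]) _) _ => [|x]; last by case: (s x).
exact: computable_snd (computable_snd computable_id).
Qed.

Lemma computable_head (z : A -> B) (s : A -> seq B) :
  computable z -> computable s -> computable (fun x => head (z x) (s x)).
Proof.
move=> cz cs; apply: computable_ext (computable_case_seq (f := fun _ b _ => b)
  cs cz _) _ => [|x]; last by case: (s x).
exact: computable_fst (computable_snd computable_id).
Qed.

(** The code of a list bounds the number of rounds of a loop that consumes it.
    *)
Lemma size_le_enc (s : seq B) : size s <= enc s.
Proof.
rewrite /enc /= /enc_seq -(size_map enc).
elim: (map _ _) => [//|a t IHt] /=.
rewrite (leq_trans _ (leq_pmull _ _)) ?expn_gt0 // ltnS -addnn.
exact: leq_trans IHt (leq_addr _ _).
Qed.

(** A loop on the pair of the accumulator and the remaining list, run as many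
    times as the code of the list; the surplus rounds do nothing on the empty
    list. *)
Lemma computable_foldl (h : A -> C -> B -> C) (z : A -> C) (s : A -> seq B) :
  computable (fun y : A * (C * B) => h y.1 y.2.1 y.2.2) ->
  computable z -> computable s ->
  computable (fun x => foldl (h x) (z x) (s x)).
Proof.
move=> ch cz cs.
pose F (x : A) (_ : nat) (y : C * seq B) :=
  match y.2 with [::] => y | b :: t => (h x y.1 b, t) end.
have cF : computable (fun y : A * (nat * (C * seq B)) => F y.1 y.2.1 y.2.2).
  have c22 : computable (fun y : A * (nat * (C * seq B)) => y.2.2).
    exact/computable_snd/computable_snd/computable_id.
  apply: computable_case_seq; [exact: computable_snd c22 | exact: c22 |].
  apply: computable_pair; last exact/computable_snd/computable_snd/computable_id.
  apply: (computable_comp (f := fun y : A * (nat * (C * seq B)) * (B * seq B) =>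
    (y.1.1, (y.1.2.2.1, y.2.1))) ch).
  apply: computable_pair.
    exact/computable_fst/computable_fst/computable_id.
  apply: computable_pair; last exact/computable_fst/computable_snd/computable_id.
  exact: computable_fst (computable_comp c22 (computable_fst computable_id)).
have cN : computable (fun x => enc (s x)).
  by have [s' rs sE] := cs; exists s'.
apply: computable_ext (computable_fst (computable_nat_rect
  (computable_pair cz cs) cN cF)) _ => x.
have: size (s x) <= enc (s x) by exact: size_le_enc.
move: (s x) (z x) (enc (s x)) => t y N.
have stop M : size t <= M ->
  nat_rect (fun=> (C * seq B)%type) (y, t) (F x) M = (foldl (h x) y t, [::]).
  (* Rounds may be peeled off at the start, as the step does not depend on the
     counter. *)
have shift N' u w : nat_rect (fun=> (C * seq B)%type) (u, w) (F x) N'.+1 =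
      nat_rect (fun=> (C * seq B)%type) (F x 0 (u, w)) (F x) N'.
    by elim: N' => [//|N' IHN] /=; congr F; rewrite -IHN.
  elim: t y M => [|b t IHt] y M.
    by move=> _; elim: M => [//|M /= ->].
  by case: M => // M le_tM; rewrite shift /F /= IHt.
by move=> /stop ->.
Qed.
End Lists.

Section MoreLists.
Context {A B C : Type} {cA : coded A} {cB : coded B} {cC : coded C}.

Lemma computable_rev (s : A -> seq B) :
  computable s -> computable (fun x => rev (s x)).
Proof.
move=> cs; apply: computable_ext (computable_foldl
  (h := fun _ t b => b :: t) _ (computable_const [::]) cs) _ => [|x].
  apply: computable_cons; first exact/computable_snd/computable_snd/computable_id.
  exact/computable_fst/computable_snd/computable_id.
rewrite /rev; elim: (s x) [::] => //= b t IHt u; exact: IHt.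
Qed.

Lemma computable_foldr (h : A -> B -> C -> C) (z : A -> C) (s : A -> seq B) :
  computable (fun y : A * (B * C) => h y.1 y.2.1 y.2.2) ->
  computable z -> computable s ->
  computable (fun x => foldr (h x) (z x) (s x)).
Proof.
move=> ch cz cs; apply: computable_ext (computable_foldl
  (h := fun x c b => h x b c) _ cz (computable_rev cs)) _ => [|x].
  apply: (computable_comp (f := fun y : A * (C * B) => (y.1, (y.2.2, y.2.1))) ch).
  apply: computable_pair; first exact: computable_fst computable_id.
  by apply: computable_pair;
    [apply: computable_snd | apply: computable_fst];
    exact: computable_snd computable_id.
by rewrite foldl_rev.
Qed.
End MoreLists.

(** Solves the goals that ask for a variable of the context, that is, a
    composite of projections. *)
Ltac computable_var :=
  solve [repeat first [exact: computable_id | apply: computable_fst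
                      | apply: computable_snd]].

Section ListFunctions.
Context {A B C : Type} {cA : coded A} {cB : coded B} {cC : coded C}.

Lemma computable_map (f : A -> B -> C) (s : A -> seq B) :
  computable (fun y : A * B => f y.1 y.2) -> computable s ->
  computable (fun x => map (f x) (s x)).
Proof.
move=> cf cs; apply: (computable_foldr (h := fun x b t => f x b :: t)) => //.
  apply: computable_cons; last computable_var.
  by apply: (computable_op2 (op := f) cf); computable_var.
exact: computable_const.
Qed.

Lemma computable_filter (p : A -> B -> bool) (s : A -> seq B) :
  computable (fun y : A * B => p y.1 y.2) -> computable s ->
  computable (fun x => filter (p x) (s x)).
Proof.
move=> cp cs; apply: computable_ext (computable_foldr
  (h := fun x b t => if p x b then b :: t else t) _
  (computable_const [::]) cs) _ => [|x].
  apply: computable_if; last 2 first.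
  - by apply: computable_cons; computable_var.
  - by computable_var.
  by apply: (computable_op2 (op := p) cp); computable_var.
by elim: (s x) => //= b t ->.
Qed.

Lemma computable_cat (s t : A -> seq B) :
  computable s -> computable t -> computable (fun x => s x ++ t x).
Proof.
move=> cs ct; apply: computable_ext (computable_foldr
  (h := fun _ b t => b :: t) _ ct cs) _ => [|x].
  by apply: computable_cons; computable_var.
by elim: (s x) => //= b u ->.
Qed.

Lemma computable_rcons (s : A -> seq B) (b : A -> B) :
  computable s -> computable b -> computable (fun x => rcons (s x) (b x)).
Proof.
move=> cs cb; apply: computable_ext (computable_cat cs
  (computable_cons cb (computable_const [::]))) _ => x.
by rewrite cats1.
Qed.

End ListFunctions.

Section ListFunctions.
Context {A B C : Type} {cA : coded A} {cB : coded B} {cC : coded C}.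

Lemma computable_flatten (s : A -> seq (seq B)) :
  computable s -> computable (fun x => flatten (s x)).
Proof.
move=> cs; apply: (computable_foldr (h := fun _ => cat)) => //.
  by apply: computable_cat; computable_var.
exact: computable_const.
Qed.

Lemma computable_all (p : A -> B -> bool) (s : A -> seq B) :
  computable (fun y : A * B => p y.1 y.2) -> computable s ->
  computable (fun x => all (p x) (s x)).
Proof.
move=> cp cs; apply: computable_ext (computable_foldr
  (h := fun x b r => if p x b then r else false) _
  (computable_const true) cs) _ => [|x].
  apply: computable_if; last 2 first.
  - by computable_var.
  - exact: computable_const.
  by apply: (computable_op2 (op := p) cp); computable_var.
by elim: (s x) => //= b t ->.
Qed.

Lemma computable_iter (n : A -> nat) (f : A -> B -> B) (z : A -> B) :
  computable n -> computable (fun y : A * B => f y.1 y.2) -> computable z ->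
  computable (fun x => iter (n x) (f x) (z x)).
Proof.
move=> cn cf cz; apply: computable_ext (computable_nat_rect
  (s := fun x _ b => f x b) cz cn _) _ => [|x].
  by apply: (computable_op2 (op := f) cf); computable_var.
by elim: (n x) => //= m ->.
Qed.

Lemma computable_S (n : A -> nat) :
  computable n -> computable (fun x => (n x).+1).
Proof. by move=> [g rg gE]; exists (fun c => (g c).+1) => [|a];
  [exact: recursive_succ | rewrite gE]. Qed.

Lemma computable_leq (m n : A -> nat) :
  computable m -> computable n -> computable (fun x => m x <= n x).
Proof.
move=> [g rg gE] [h rh hE]; exists (fun c => g c - h c == 0) => [|a].
  exact/recursive_eq0/recursive_sub.
by rewrite gE hE.
Qed.

Lemma computable_negb (b : A -> bool) :
  computable b -> computable (fun x => ~~ b x).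
Proof.
move=> cb; apply: computable_ext (computable_if cb (computable_const false)
  (computable_const true)) _ => x.
by case: (b x).
Qed.

Lemma computable_andb (b c : A -> bool) :
  computable b -> computable c -> computable (fun x => b x && c x).
Proof.
move=> cb cc; apply: computable_ext (computable_if cb cc (computable_const false)) _.
by move=> x; case: (b x).
Qed.

End ListFunctions.

Section ListFunctions.
Context {A B C : Type} {cA : coded A} {cB : coded B} {cC : coded C}.

Lemma computable_nth (z : A -> B) (s : A -> seq B) (n : A -> nat) :
  computable z -> computable s -> computable n ->
  computable (fun x => nth (z x) (s x) (n x)).
Proof.
move=> cz cs cn; apply: computable_ext (computable_head cz (computable_iter
  (f := fun _ => behead) cn _ cs)) _ => [|x].
  by apply: computable_behead; computable_var.
rewrite -nth0 -(addn0 (n x)) -nth_drop addn0; congr nth.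
by elim: (n x) (s x) => [|m IHm] t; rewrite ?drop0 // iterSr IHm -drop1 drop_drop addn1.
Qed.

Lemma computable_size (s : A -> seq B) :
  computable s -> computable (fun x => size (s x)).
Proof.
move=> cs; apply: computable_ext (computable_foldr
  (h := fun _ _ => S) _ (computable_const 0) cs) _ => [|x].
  by apply: computable_S; computable_var.
by elim: (s x) => //= b t ->.
Qed.

Lemma computable_iota0 (n : A -> nat) :
  computable n -> computable (fun x => iota 0 (n x)).
Proof.
move=> cn; apply: computable_ext (computable_nat_rect
  (s := fun _ i s => rcons s i) (computable_const [::]) cn _) _ => [|x].
  by apply: computable_rcons; computable_var.
by elim: (n x) => //= m ->; rewrite -cats1 -(iotaD 0 m 1) addn1.
Qed.

End ListFunctions.

Lemma computable_eq A (B : eqType) {cA : coded A} {cB : coded B} (f g : A -> B) :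
  computable f -> computable g -> computable (fun x => f x == g x).
Proof.
move=> [f' rf fE] [g' rg gE].
have cle : computable (fun x => (enc (f x) <= enc (g x)) && (enc (g x) <= enc (f x))).
  by apply: computable_andb; apply: computable_leq; [exists f'|exists g'|exists g'|exists f'].
by apply: computable_ext cle _ => x; rewrite -eqn_leq (inj_eq enc_inj).
Qed.

Lemma computable_perm_eq A (B : eqType) {cA : coded A} {cB : coded B} (s t : A -> seq B) :
  computable s -> computable t -> computable (fun x => perm_eq (s x) (t x)).
Proof.
move=> cs ct.
have ccount (u : A -> seq B) : computable u ->
  computable (fun y : A * B => size (filter (pred1 y.2) (u y.1))).
  move=> cu; apply: computable_size; apply: computable_filter.
    by apply: computable_eq; computable_var.
  by apply: (computable_comp cu); computable_var.
apply: computable_ext (computable_all (p := fun x b =>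
  size (filter (pred1 b) (s x)) == size (filter (pred1 b) (t x))) _
  (computable_cat cs ct)) _ => [|x].
  by apply: computable_eq; exact: ccount.
by rewrite /perm_eq; apply: eq_all => b /=; rewrite !size_filter.
Qed.

(** The test [T] receives the argument decoded; because each argument has a
    witness, minimization is applied to a regular function. *)
Lemma computable_search A {cA : coded A} (T : nat * A -> bool) :
  computable T -> (forall a, exists w, T (w, a)) ->
  forall (dec : nat -> A), computable dec ->
  exists2 w : nat -> nat, computable w & forall c, T (w c, dec c).
Proof.
move=> cT exT dec cdec.
have [g rg gE] : computable (fun y : nat * nat => T (y.1, dec y.2)).
  apply: (computable_comp cT); apply: computable_pair; first computable_var.
  by apply: (computable_comp cdec); computable_var.
have ex c : exists w, T (w, dec c) by exact: exT.
exists (fun c => ex_minn (ex c)) => [|c]; last by case: ex_minnP.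
exists (fun c => ex_minn (ex c)) => //.
pose G (v : 2.-tuple nat) : nat :=
  g (code_cons (nth 0 v 0) (code_cons (nth 0 v 1) 0)) == 0.
have rG : recursive G.
  apply/recursive_eq0/(recursive_comp1 rg).
  by do ! [apply: recursive_code_cons | apply: recursive_nth
         | apply: recursive_const].
have GE i c : G [tuple i; c] = ~~ T (i, dec c).
  by rewrite /G (gE (i, c)) /enc /=; case: (T _).
have tupleE i (v : 1.-tuple nat) : [tuple of i :: v] = [tuple i; nth 0 v 0].
  by apply: eq_from_tnth => j; rewrite !(tnth_nth 0); case: j => [[|[|]]].
apply: (rec_min rG) => v; case: ex_minnP => w Tw min_w; rewrite tupleE GE Tw.
split=> // i lt_iw; rewrite tupleE GE.
by case: (boolP (T _)) => // /min_w; rewrite leqNgt lt_iw.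
Qed.

Local Open Scope ring_scope.

(** * Programs on presentations *)

(** A variable is its index and its order; a term is the number of its
    coefficient and the list of its variables. *)
Notation rvar := (nat * nat)%type.
Notation rterm := (nat * seq (nat * nat))%type.
Notation rpres := (seq (nat * seq (nat * nat))).

Section Programs.
Variables (c0 c1 : nat) (addc mulc : nat -> nat -> nat) (eqc : nat -> nat -> bool).

Definition scale_term (t u : rterm) : rterm := (mulc t.1 u.1, t.2 ++ u.2).

Definition pmul (a b : rpres) : rpres := flatten [seq [seq scale_term t u | u <- b] | t <- a].

(** The Leibniz rule along the list of variables of a term; the fold returns
    the part of the list already read together with its derivative. *)
Definition tder (phi : rvar -> rpres) (t : rterm) : rpres :=
  pmul [:: (t.1, [::])]
    (foldr (fun x (y : seq rvar * rpres) => (x :: y.1,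
         pmul (phi x) [:: (c1, y.1)] ++ pmul [:: (c1, [:: x])] y.2))
       ([::], [::]) t.2).2.

Definition pderive (phi : rvar -> rpres) (s : rpres) : rpres := flatten (map (tder phi) s).

Definition xpres (v : rvar) : rpres := [:: (c1, [:: v])].

Definition pdelta : rpres -> rpres := pderive (fun v => xpres (v.1, v.2.+1)).

Definition ppartial (v : rvar) : rpres -> rpres :=
  pderive (fun w => if w == v then [:: (c1, [::])] else [::]).

(** Variables with no entry in [G] are replaced by 0. *)
Definition psub (G : seq rpres) (s : rpres) : rpres :=
  flatten [seq foldr (fun v => pmul (iter v.2 pdelta (nth [::] G v.1))) [:: (t.1, [::])] t.2 | t <- s].

Definition wf_term n (t : rterm) : bool := all (fun v => v.1 < n)%N t.2.

Definition coef_at (l : seq rvar) (s : rpres) : nat :=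
  foldr (fun t => addc t.1) c0 [seq t <- s | perm_eq l t.2].

(** Terms with variables of index [n] or more denote 0 and are discarded; the
    others must cancel monomial by monomial. *)
Definition pzero n (s : rpres) : bool :=
  all (fun t => eqc (coef_at t.2 [seq t <- s | wf_term n t]) c0) [seq t <- s | wf_term n t].

Definition test_dependent n (F : seq rpres) (h : rpres) : bool :=
  ~~ pzero (size F) h && pzero n (psub F h).

(** Checks a certificate: [J] holds the added elements, and the [j]-th entry of
    [R] the equation of x_j with the order of the derivative of the last
    variable in which it is differentiated. *)
Definition test_independent n (F J : seq rpres) (R : seq (rpres * nat)) : bool :=
  (size (F ++ J) <= n)%N && all (fun j =>
    pzero n (psub (rcons (F ++ J) (xpres (j, 0%N))) (nth ([::], 0%N) R j).1) &&
    ~~ pzero n (psub (rcons (F ++ J) (xpres (j, 0%N)))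
        (ppartial (size (F ++ J), (nth ([::], 0%N) R j).2) (nth ([::], 0%N) R j).1)))
    (iota 0 n).

(** * Meaning of the programs *)

Section Denotation.
Variables (k : fieldType) (nu : nat -> k).
Hypotheses (nu0 : nu c0 = 0) (nu1 : nu c1 = 1).
Hypothesis nuD : forall a b, nu (addc a b) = nu a + nu b.
Hypothesis nuM : forall a b, nu (mulc a b) = nu a * nu b.
Hypothesis nuE : forall a b, eqc a b <-> nu a = nu b.
Hypothesis nu_onto : forall x, exists a, nu a = x.

Section Abstract.
Variable P : forall n : nat, polyAlg k ('I_n * nat)%type.

(** Variables of index [n] or more denote 0, so that every presentation has a
    meaning in every number of variables. *)
Definition xvar n (v : rvar) : P n :=
  if insub v.1 is Some i then pX (i : 'I_n, v.2) else 0.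

Lemma xvar_in n (v : rvar) : (v.1 < n)%N ->
  exists2 i : 'I_n, insub v.1 = Some i & xvar n v = pX (i, v.2).
Proof.
by move=> lt_v; exists (Ordinal lt_v); rewrite /xvar insubT.
Qed.

Lemma xvar_val n (i : 'I_n) r : xvar n (val i, r) = pX (i, r).
Proof. by rewrite /xvar /= valK. Qed.

Definition den n (s : rpres) : P n :=
  \sum_(t <- s) pC (P n) (nu t.1) * \prod_(v <- t.2) xvar n v.

Variable n : nat.
Local Notation dn := (den n).

Lemma den_nil : dn [::] = 0.
Proof. exact: big_nil. Qed.

Lemma den_cat a b : dn (a ++ b) = dn a + dn b.
Proof. exact: big_cat. Qed.

Lemma den_flatten (s : seq rpres) : dn (flatten s) = \sum_(a <- s) dn a.
Proof. by elim: s => [|a s IHs]; rewrite ?big_nil ?den_nil // big_cons -IHs -den_cat. Qed.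

Lemma den1 c l : dn [:: (c, l)] = pC (P n) (nu c) * \prod_(v <- l) xvar n v.
Proof. exact: big_seq1. Qed.

Lemma den_const c : dn [:: (c, [::])] = pC (P n) (nu c).
Proof. by rewrite den1 big_nil mulr1. Qed.

Lemma den_xpres v : dn (xpres v) = xvar n v.
Proof. by rewrite den1 nu1 rmorph1 mul1r big_seq1. Qed.

Lemma den_pmul a b : dn (pmul a b) = dn a * dn b.
Proof.
rewrite den_flatten big_map /den mulr_suml; apply: eq_bigr => t _.
rewrite big_map mulr_sumr; apply: eq_bigr => u _ /=.
by rewrite nuM rmorphM big_cat /= mulrACA.
Qed.

(** One program for all derivations: it suffices that [phi] presents the values
    on variables. *)
Lemma den_pderive (D : P n -> P n) (phi : rvar -> rpres) s :
  derivation (pC (P n)) (fun f => f) D -> (forall v, dn (phi v) = D (xvar n v)) ->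
  dn (pderive phi s) = D (dn s).
Proof.
move=> dD Dphi; rewrite den_flatten big_map {2}/den.
have -> : D (\sum_(t <- s) pC (P n) (nu t.1) * \prod_(v <- t.2) xvar n v) =
    \sum_(t <- s) D (pC (P n) (nu t.1) * \prod_(v <- t.2) xvar n v).
  elim/big_rec2: _ => [|t y1 y2 _ <-]; first exact: derivation0 dD.
  exact: derivationD dD _ _.
apply: eq_bigr => -[c l] _ /=; rewrite (derivationM dD) (derivationC dD) mul0r addr0.
rewrite den_pmul den_const; congr (_ * _); rewrite /tder /=.
set step := (fun x y => _).
have fst_foldr : (foldr step ([::], [::]) l).1 = l by elim: l => //= x l ->.
elim: l fst_foldr => [|x l IHl] fst_foldr /=.
  rewrite den_nil big_nil -(rmorph1 (pC (P n))); symmetry; exact: (derivationC dD).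
case: fst_foldr => fst_foldr; rewrite fst_foldr den_cat !den_pmul Dphi IHl //.
by rewrite den1 nu1 rmorph1 mul1r den_xpres big_cons (derivationM dD) addrC.
Qed.

Lemma den_pdelta s : dn (pdelta s) = ddelta (dn s).
Proof.
apply: den_pderive; first exact: ddelta_derivation.
move=> v; rewrite den_xpres /xvar /=; case: insubP => [i _ _|_]; first by rewrite ddeltaX.
by rewrite ddelta0.
Qed.

Lemma den_ppartial (i : 'I_n) r s : dn (ppartial (val i, r) s) = pdiff (i, r) (dn s).
Proof.
apply: den_pderive; first exact: pdiff_derivation.
move=> -[j e]; rewrite /xvar /=; case: insubP => [l _ <-|out].
  rewrite pdiffX !xpair_eqE /= -val_eqE /=.
  by case: ifP => _; rewrite ?den_const ?nu1 ?rmorph1 ?den_nil.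
rewrite (derivation0 (pdiff_derivation (P n) _)) xpair_eqE /=.
by case: eqP => [Ej|_]; [rewrite Ej ltn_ord in out | rewrite den_nil].
Qed.

Lemma den_iter_pdelta r s : dn (iter r pdelta s) = iter r (@ddelta k P n) (dn s).
Proof. by elim: r => //= r IHr; rewrite den_pdelta IHr. Qed.

End Abstract.

Lemma den_psub (P : forall n, polyAlg k ('I_n * nat)%type) n (G : seq rpres) q (s : rpres) : size G = q ->
  den P n (psub G s) = dsub (nthf (P := P) (map (den P n) G) (q := q)) (den P q s).
Proof.
move=> Eq; rewrite den_flatten big_map /(den P q) rmorph_sum; apply: eq_bigr => -[c l] _ /=.
rewrite rmorphM dsubC rmorph_prod; elim: l => [|v l IHl] /=.
  by rewrite big_nil mulr1 den_const.
rewrite den_pmul IHl big_cons mulrCA; congr (_ * _).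
rewrite den_iter_pdelta /xvar; case: insubP => [i lt_i Ei|out].
  by rewrite dsubX /nthf /= Ei (nth_map [::]) ?Eq.
by rewrite rmorph0 nth_default ?den_nil ?iter_ddelta0 // leqNgt Eq.
Qed.

Lemma den_onto (P : forall n, polyAlg k ('I_n * nat)%type) n (f : P n) : exists s, den P n s = f.
Proof.
elim: (gen_all f) => [a|[i r] _|g h _ [s <-] _ [t <-]|g h _ [s <-] _ [t <-]].
- by have [c <-] := nu_onto a; exists [:: (c, [::])]; rewrite den_const.
- by exists (xpres (val i, r)); rewrite den_xpres xvar_val.
- by exists (s ++ t); rewrite den_cat.
- by exists (pmul s t); rewrite den_pmul.
Qed.

Section ZeroTest.
Variables (char0 : [pchar k] =i pred0) (n : nat).
Local Notation M := (dpoly_alg char0).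

Definition mono (l : seq rvar) : dmonom n :=
  \big[mmul/mone]_(v <- l) (if insub v.1 is Some i then ucm (i : 'I_n, v.2) else mone).

Lemma monoE l (w : 'I_n * nat) : mono l w = count_mem (val w.1, w.2) l.
Proof.
rewrite /mono; elim: l => [|[j e] l IHl] /=; first by rewrite big_nil cm1.
rewrite big_cons cmM IHl; congr (_ + _)%N; case: insubP => [i _ Ei|out].
  by rewrite ucmE; case: w {IHl} => w1 w2; rewrite !xpair_eqE -val_eqE /= Ei.
rewrite cm1 xpair_eqE; case: eqP => [Ej|//].
by rewrite Ej /= ltn_ord in out.
Qed.

Lemma mono_prod l : all (fun v => v.1 < n)%N l ->
  \prod_(v <- l) xvar M n v = << mono l >> :> dpoly k n.
Proof.
elim: l => [|v l IHl] /=; first by rewrite /mono !big_nil.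
case/andP => lt_v /IHl E; apply: etrans (big_cons _ _ _ _ _ _) _.
have -> : mono (v :: l) =
    mmul (if insub v.1 is Some i then ucm (i : 'I_n, v.2) else mone) (mono l).
  exact: big_cons.
have [i Ei Ex] := xvar_in M lt_v; rewrite Ei.
apply: etrans (congr2 (fun f g : dpoly k n => f * g) Ex E) _.
exact: esym (monomM _ _ _).
Qed.

(** Monomials are equal when their lists of variables are permutations of each
    other, which is what [pzero] tests. *)
Lemma mono_eq l1 l2 : all (fun v => v.1 < n)%N l1 -> all (fun v => v.1 < n)%N l2 ->
  (mono l1 == mono l2) = perm_eq l1 l2.
Proof.
move=> /allP wf1 /allP wf2; apply/cmP/idP => [E|/permP p w].
  apply/allP => -[j e] j_l; have lt_j : (j < n)%N.
    by move: j_l; rewrite mem_cat => /orP [/wf1|/wf2].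
  by have := E (Ordinal lt_j, e); rewrite !monoE /= => ->.
by rewrite !monoE p.
Qed.

Lemma nu_coef_at l s :
  nu (coef_at l s) = \sum_(t <- s | perm_eq l t.2) nu t.1.
Proof.
rewrite -big_filter /coef_at; elim: [seq _ <- s | _] => [|t s' IHs] /=.
  by rewrite big_nil nu0.
by rewrite nuD IHs big_cons.
Qed.

Lemma den_wf s : den M n [seq t <- s | wf_term n t] = den M n s.
Proof.
rewrite /den big_filter [RHS](bigID (wf_term n)) /= [X in _ = _ + X]big1 ?addr0 //.
move=> t /allPn [v v_t lt_v]; rewrite (big_rem v) //= {1}/xvar.
by rewrite insubN // mul0r mulr0.
Qed.

Lemma mcoeff_den s m : all (wf_term n) s ->
  (den M n s : dpoly k n)@_m = \sum_(t <- s) nu t.1 * (mono t.2 == m)%:R.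
Proof.
move=> /allP wf_s; rewrite /den raddf_sum; apply: eq_big_seq => t /wf_s wf_t.
have E := mono_prod wf_t.
apply: etrans (congr1 (fun f : dpoly k n => ((nu t.1)%:MP * f)@_m) E) _.
by rewrite mcoeffCM mcoeffU1.
Qed.

Lemma pzeroP s : pzero n s <-> den M n s = 0.
Proof.
rewrite -den_wf /pzero; set s' := [seq t <- s | _].
have wf_s' : all (wf_term n) s' by exact: filter_all.
have wfP u : u \in s' -> all (fun v => v.1 < n)%N u.2 by exact: (allP wf_s').
have coefE t : t \in s' -> (den M n s' : dpoly k n)@_(mono t.2) = nu (coef_at t.2 s').
  move=> t_s; rewrite mcoeff_den // nu_coef_at [RHS]big_mkcond.
  apply: eq_big_seq => u u_s; rewrite mono_eq ?wfP //.
  by rewrite perm_sym; case: ifP; rewrite ?mulr1 ?mulr0.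
split=> [/allP zs|z0].
  suff : (den M n s' : dpoly k n) = 0 by [].
  apply/malgP => m; rewrite mcoeff0.
  have [[t t_s Et]|no] := classic (exists2 t, t \in s' & mono t.2 = m).
    by rewrite -Et coefE //; rewrite -nu0; apply/nuE/zs.
  rewrite mcoeff_den // big_seq big1 // => t t_s.
  by case: eqP => [Et|_]; [case: no; exists t | rewrite mulr0].
apply/allP => t t_s; apply/nuE; rewrite nu0 -coefE //.
exact: etrans (congr1 (fun f : dpoly k n => f@_(mono t.2)) z0) (mcoeff0 _).
Qed.
End ZeroTest.

Section Tests.
Variable char0 : [pchar k] =i pred0.
Local Notation M := (dpoly_alg char0).
Local Notation dep n F := (dependent (P := M) (nthf (P := M) (map (den M n) F) (q := size F))).

Lemma pzeroPn n s : ~~ pzero n s <-> den M n s != 0.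
Proof.
split=> [/negP z|/eqP z]; first by apply/eqP => /(pzeroP char0).
by apply/negP => /(pzeroP char0).
Qed.

(** Every relation has a presentation. *)
Lemma test_dependentP n (F : seq rpres) :
  (exists h, test_dependent n F h) <-> dep n F.
Proof.
split=> [[h /andP [/pzeroPn h0 /(pzeroP char0) Rh]]|[h h0 Rh]].
  by exists (den M (size F) h) => //; rewrite -(den_psub M n h (erefl (size F))).
have [s Es] := den_onto h; exists s; apply/andP; split.
  by apply/pzeroPn; rewrite Es.
by apply/(pzeroP char0); rewrite (den_psub M n s (erefl (size F))) Es.
Qed.

Lemma den_onto_seq n (G : seq (M n)) : exists s, map (den M n) s = G.
Proof.
elim: G => [|f G [s Es]]; first by exists [::].
by have [t Et] := den_onto f; exists (t :: s); rewrite /= Et Es.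
Qed.

Lemma test_independentP n (F : seq rpres) :
  (exists J R, test_independent n F J R) <-> ~ dep n F.
Proof.
pose x (J : seq rpres) (j : 'I_n) := rcons (F ++ J) (xpres (val j, 0%N)).
have xE J j : map (den M n) (x J j) =
    rcons (map (den M n) F ++ map (den M n) J) (pX (j, 0%N)).
  by rewrite map_rcons map_cat den_xpres xvar_val.
have subE J j q p : size (F ++ J) = q ->
    den M n (psub (x J j) p) =
    dsub (nthf (P := M) (map (den M n) (x J j)) (q := q.+1)) (den M q.+1 p).
  by move=> Eq; apply: den_psub; rewrite size_rcons Eq.
have subE' J j q p r : size (F ++ J) = q ->
    den M n (psub (x J j) (ppartial (q, r) p)) =
    dsub (nthf (P := M) (map (den M n) (x J j)) (q := q.+1))
      (pdiff (ord_max, r) (den M q.+1 p)).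
  by move=> Eq; rewrite (subE _ _ _ _ Eq) -[q in (q, r)]/(val (@ord_max q)) den_ppartial.
apply: iff_trans _ (independence_certificate_size (size_map (den M n) F)).
split=> [[J [R /andP [le_n /allP tests]]]|[J' [q [Eq le_n pP]]]].
  exists (map (den M n) J), (size (F ++ J)); split=> [|//|j].
    by rewrite -map_cat size_map.
  have := tests (val j); rewrite mem_iota ltn_ord => /(_ isT) /andP.
  set pr := nth _ R j => -[/(pzeroP char0) z /pzeroPn s].
  exists (den M (size (F ++ J)).+1 pr.1), pr.2; rewrite -xE.
  by rewrite -(subE J j _ _ erefl) -(subE' J j _ _ _ erefl).
have [J EJ] := den_onto_seq J'; subst J'.
have {Eq}Eq : size (F ++ J) = q by rewrite -Eq -map_cat size_map.
have [p {}pP] := fin_all_exists pP; have [r {}pP] := fin_all_exists pP.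
have [s Es] := fin_all_exists (fun j => den_onto (p j)).
exists J, [seq (s j, r j) | j <- enum 'I_n]; apply/andP; split; first by rewrite Eq.
apply/allP => j0; rewrite mem_iota /= add0n => lt_j0.
rewrite -[j0]/(val (Ordinal lt_j0)); move: (Ordinal lt_j0) => j.
have -> : nth ([::], 0%N) [seq (s j, r j) | j <- enum 'I_n] (val j) = (s j, r j).
  by rewrite (nth_map j) ?size_enum_ord ?ltn_ord // nth_ord_enum.
have [z n0] := pP j; rewrite -(xE J) -Es in z n0; rewrite -/(x J j) Eq.
rewrite -[(s j, r j).1]/(s j) -[(s j, r j).2]/(r j); apply/andP; split.
  by apply/(pzeroP char0); rewrite (subE J j q (s j) Eq).
by apply/pzeroPn; rewrite (subE' J j q (s j) (r j) Eq).
Qed.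
End Tests.
End Denotation.
End Programs.

(** * Computability of the programs *)
Local Close Scope ring_scope.

Section Programs.
Variables (c0 c1 : nat) (addc mulc : nat -> nat -> nat) (eqc : nat -> nat -> bool).
Hypothesis cadd : computable (fun x : nat * nat => addc x.1 x.2).
Hypothesis cmul : computable (fun x : nat * nat => mulc x.1 x.2).
Hypothesis ceq : computable (fun x : nat * nat => eqc x.1 x.2).

Section Context.
Context {A : Type} {cA : coded A}.

Lemma computable_pmul (a b : A -> rpres) :
  computable a -> computable b -> computable (fun x => pmul mulc (a x) (b x)).
Proof.
move=> ca cb; apply: computable_flatten; apply: computable_map ca.
apply: computable_map; last by apply: (computable_comp cb); computable_var.
apply: computable_pair; last by apply: computable_cat; computable_var.
by apply: (computable_op2 cmul); computable_var.
Qed.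

Lemma computable_seq1 B {cB : coded B} (f : A -> B) :
  computable f -> computable (fun x => [:: f x]).
Proof. by move=> cf; apply: computable_cons => //; apply: computable_const. Qed.

Lemma computable_xpres (v : A -> rvar) :
  computable v -> computable (fun x => xpres c1 (v x)).
Proof.
move=> cv; apply/computable_seq1/computable_pair; first exact: computable_const.
exact: computable_seq1.
Qed.
End Context.

Section Context2.
Context {A : Type} {cA : coded A}.

Lemma computable_pderive (phi : A -> rvar -> rpres) (s : A -> rpres) :
  computable (fun x : A * rvar => phi x.1 x.2) -> computable s ->
  computable (fun x => pderive c1 mulc (phi x) (s x)).
Proof.
move=> cphi cs; apply: computable_flatten; apply: computable_map cs.
apply: computable_pmul.
  apply/computable_seq1/computable_pair; first by computable_var.
  exact: computable_const.
apply: computable_snd; apply: (computable_foldr (h := fun (x : A * rterm) v (y : seq rvar * rpres) =>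
  (v :: y.1, pmul mulc (phi x.1 v) [:: (c1, y.1)] ++ pmul mulc [:: (c1, [:: v])] y.2))).
- apply: computable_pair; first by apply: computable_cons; computable_var.
  apply: computable_cat; apply: computable_pmul.
  + by apply: (computable_op2 (op := phi) cphi); computable_var.
  + by apply/computable_seq1/computable_pair; [exact: computable_const | computable_var].
  + by apply: (computable_xpres (v := fun y => y.2.1)); computable_var.
  + by computable_var.
- exact: computable_const.
- by computable_var.
Qed.
End Context2.

Section Context3.
Context {A : Type} {cA : coded A}.

Lemma computable_pdelta (s : A -> rpres) :
  computable s -> computable (fun x => pdelta c1 mulc (s x)).
Proof.
move=> cs; apply: computable_pderive cs; apply: computable_xpres.
by apply: computable_pair; [|apply: computable_S]; computable_var.
Qed.

Lemma computable_ppartial (v : A -> rvar) (s : A -> rpres) :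
  computable v -> computable s -> computable (fun x => ppartial c1 mulc (v x) (s x)).
Proof.
move=> cv cs; apply: (computable_pderive (phi := fun x w => if w == v x then [:: (c1, [::])] else [::])) cs.
apply: computable_if; try exact: computable_const.
apply: computable_eq; first by computable_var.
by apply: (computable_comp cv); computable_var.
Qed.
End Context3.

Section Context4.
Context {A : Type} {cA : coded A}.

Lemma computable_psub (G : A -> seq rpres) (s : A -> rpres) :
  computable G -> computable s -> computable (fun x => psub c1 mulc (G x) (s x)).
Proof.
move=> cG cs; apply: computable_flatten; apply: computable_map cs.
apply: (computable_foldr (h := fun (x : A * rterm) v =>
  pmul mulc (iter v.2 (pdelta c1 mulc) (nth [::] (G x.1) v.1)))).
- apply: computable_pmul; last by computable_var.
  apply: (computable_iter (f := fun _ => pdelta c1 mulc)); first by computable_var.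
    by apply: computable_pdelta; computable_var.
  apply: computable_nth; first exact: computable_const.
    by apply: (computable_comp cG); computable_var.
  by computable_var.
- by apply/computable_seq1/computable_pair; [computable_var | exact: computable_const].
- by computable_var.
Qed.

Lemma computable_wf (n : A -> nat) (t : A -> rterm) :
  computable n -> computable t -> computable (fun x => wf_term (n x) (t x)).
Proof.
move=> cn ct; apply: (computable_all (p := fun x v => (v.1 < n x))); last by apply: computable_snd.
by apply: computable_leq; [apply: computable_S; computable_var | apply: (computable_comp cn); computable_var].
Qed.

Lemma computable_coef_at (l : A -> seq rvar) (s : A -> rpres) :
  computable l -> computable s -> computable (fun x => coef_at c0 addc (l x) (s x)).
Proof.
move=> cl cs; apply: (computable_foldr (h := fun _ (t : rterm) => addc t.1)).
- by apply: (computable_op2 cadd); computable_var.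
- exact: computable_const.
apply: (computable_filter (p := fun x t => perm_eq (l x) t.2)) => //.
apply: computable_perm_eq; last by computable_var.
by apply: (computable_comp cl); computable_var.
Qed.
End Context4.

Section Context5.
Context {A : Type} {cA : coded A}.

Lemma computable_pzero (n : A -> nat) (s : A -> rpres) :
  computable n -> computable s -> computable (fun x => pzero c0 addc eqc (n x) (s x)).
Proof.
move=> cn cs.
have cwf : computable (fun x => [seq t <- s x | wf_term (n x) t]).
  apply: (computable_filter (p := fun x => wf_term (n x))) => //.
  by apply: computable_wf; [apply: (computable_comp cn)|]; computable_var.
apply: (computable_all (p := fun x t =>
  eqc (coef_at c0 addc t.2 [seq t <- s x | wf_term (n x) t]) c0)) => //.
apply: (computable_op2 ceq); last exact: computable_const.
by apply: computable_coef_at; [|apply: (computable_comp cwf)]; computable_var.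
Qed.
End Context5.

Section Context6.
Context {A : Type} {cA : coded A}.

Lemma computable_test_dependent (n : A -> nat) (F : A -> seq rpres) (h : A -> rpres) :
  computable n -> computable F -> computable h ->
  computable (fun x => test_dependent c0 c1 addc mulc eqc (n x) (F x) (h x)).
Proof.
move=> cn cF ch; apply: computable_andb.
  by apply/computable_negb/computable_pzero => //; apply: computable_size.
by apply: computable_pzero => //; apply: computable_psub.
Qed.

Lemma computable_test_independent (n : A -> nat) (F J : A -> seq rpres)
    (R : A -> seq (rpres * nat)) :
  computable n -> computable F -> computable J -> computable R ->
  computable (fun x => test_independent c0 c1 addc mulc eqc (n x) (F x) (J x) (R x)).
Proof.
move=> cn cF cJ cR; have cFJ := computable_cat cF cJ.
apply: computable_andb; first by apply: computable_leq => //; apply: computable_size.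
apply: (computable_all (p := fun x j =>
    pzero c0 addc eqc (n x) (psub c1 mulc (rcons (F x ++ J x) (xpres c1 (j, 0))) (nth ([::], 0) (R x) j).1) &&
    ~~ pzero c0 addc eqc (n x) (psub c1 mulc (rcons (F x ++ J x) (xpres c1 (j, 0)))
        (ppartial c1 mulc (size (F x ++ J x), (nth ([::], 0) (R x) j).2) (nth ([::], 0) (R x) j).1)))).
  have cn' : computable (fun y : A * nat => n y.1) by apply: (computable_comp cn); computable_var.
  have cFJ' : computable (fun y : A * nat => F y.1 ++ J y.1).
    by apply: (computable_comp cFJ); computable_var.
  have cx : computable (fun y : A * nat => rcons (F y.1 ++ J y.1) (xpres c1 (y.2, 0))).
    apply: computable_rcons => //; apply: computable_xpres; apply: computable_pair.
      by computable_var.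
    exact: computable_const.
  have cR' : computable (fun y : A * nat => nth ([::], 0) (R y.1) y.2).
    apply: computable_nth; first exact: computable_const.
      by apply: (computable_comp cR); computable_var.
    by computable_var.
  have c1R := computable_fst cR'; have c2R := computable_snd cR'.
  apply: computable_andb; first by apply: computable_pzero => //; apply: computable_psub.
  apply/computable_negb/computable_pzero => //; apply: computable_psub => //.
  by apply: computable_ppartial => //; apply: computable_pair => //; apply: computable_size.
exact: computable_iota0.
Qed.
End Context6.
End Programs.

(** * Decoding inputs and certificates *)

Section Decoding.

(** A decoder defined on all numbers, whether or not they are codes of
    variables; this is what makes the search total. *)
Definition dec_var (c : nat) : rvar :=
  (nth 0 (CodeSeq.decode c) 0, nth 0 (CodeSeq.decode c) 1).
Definition dec_term (c : nat) : rterm :=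
  (head 0 (CodeSeq.decode c), map dec_var (behead (CodeSeq.decode c))).
Definition dec_seq T (dec : nat -> T) (c : nat) : seq T := map dec (CodeSeq.decode c).
Definition dec_pres : nat -> rpres := dec_seq dec_term.
Definition dec_sys : nat -> seq rpres := dec_seq dec_pres.
Definition dec_pair (c : nat) : rpres * nat :=
  (dec_pres (nth 0 (CodeSeq.decode c) 0), nth 0 (CodeSeq.decode c) 1).
Definition dec_input (c : nat) : nat * seq rpres :=
  (nth 0 (CodeSeq.decode c) 0, dec_sys (nth 0 (CodeSeq.decode c) 1)).

Lemma computable_decode : computable CodeSeq.decode.
Proof.
exists id => [|c]; first exact: recursive_nth.
by rewrite /enc /= /enc_seq map_id CodeSeq.decodeK.
Qed.

Lemma computable_decode_nth i : computable (fun c => nth 0 (CodeSeq.decode c) i).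
Proof. by apply: computable_nth computable_decode _; apply: computable_const. Qed.

Lemma computable_dec_var : computable dec_var.
Proof. by apply: computable_pair; apply: computable_decode_nth. Qed.

Lemma computable_dec_seq T {cT : coded T} (dec : nat -> T) :
  computable dec -> computable (dec_seq dec).
Proof.
move=> cdec; apply: (computable_map (f := fun _ => dec)) computable_decode.
by apply: (computable_comp cdec); computable_var.
Qed.

Lemma computable_dec_term : computable dec_term.
Proof.
apply: computable_pair.
  by apply: computable_head computable_decode; apply: computable_const.
apply: (computable_map (f := fun _ => dec_var)); last exact: computable_behead computable_decode.
by apply: (computable_comp computable_dec_var); computable_var.
Qed.

Lemma computable_dec_pres : computable dec_pres.
Proof. exact/computable_dec_seq/computable_dec_term. Qed.

Lemma computable_dec_sys : computable dec_sys.
Proof. exact/computable_dec_seq/computable_dec_pres. Qed.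

Lemma computable_dec_pair : computable dec_pair.
Proof.
apply: computable_pair; last exact: computable_decode_nth.
exact: computable_comp computable_dec_pres (computable_decode_nth 0).
Qed.

Lemma computable_dec_input : computable dec_input.
Proof.
apply: computable_pair; first exact: computable_decode_nth.
exact: computable_comp computable_dec_sys (computable_decode_nth 1).
Qed.

Lemma dec_seq_onto T (dec : nat -> T) : (forall x, exists c, dec c = x) ->
  forall s, exists c, dec_seq dec c = s.
Proof.
move=> onto s; suff [w <-] : exists w, map dec w = s.
  by exists (CodeSeq.code w); rewrite /dec_seq CodeSeq.codeK.
elim: s => [|x s [w <-]]; first by exists [::].
by have [c <-] := onto x; exists (c :: w).
Qed.

Lemma dec_var_onto v : exists c, dec_var c = v.
Proof.
by case: v => i r; exists (CodeSeq.code [:: i; r]); rewrite /dec_var CodeSeq.codeK.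
Qed.

Lemma dec_term_onto t : exists c, dec_term c = t.
Proof.
case: t => a l; have [c <-] := dec_seq_onto dec_var_onto l.
by exists (CodeSeq.code (a :: CodeSeq.decode c)); rewrite /dec_term CodeSeq.codeK.
Qed.

Lemma dec_pres_onto s : exists c, dec_pres c = s.
Proof. exact: dec_seq_onto dec_term_onto s. Qed.

Lemma dec_pair_onto x : exists c, dec_pair c = x.
Proof.
case: x => s r; have [c <-] := dec_pres_onto s.
by exists (CodeSeq.code [:: c; r]); rewrite /dec_pair CodeSeq.codeK.
Qed.

(** A presentation with its bounded indices seen as numbers. *)
Definition forget n (s : presentation n) : rpres :=
  [seq (t.1, [seq (nat_of_ord v.1, v.2) | v <- t.2]) | t <- s].

Lemma dec_sysK n (F : seq (presentation n)) :
  dec_sys (code_system F) = map (@forget n) F.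
Proof.
rewrite /dec_sys /dec_seq /code_system CodeSeq.codeK -map_comp; apply: eq_map => s /=.
rewrite /dec_pres /dec_seq /code_presentation CodeSeq.codeK -map_comp; apply: eq_map => t /=.
rewrite /dec_term /code_term CodeSeq.codeK /= -map_comp; congr (_, _); apply: eq_map => v /=.
by rewrite /dec_var /code_var CodeSeq.codeK.
Qed.

End Decoding.

Local Open Scope ring_scope.

(** * The decision procedure *)

Lemma denote_forget (k : fieldType) (char0 : [pchar k] =i pred0) (nu : nat -> k) n
    (s : presentation n) :
  den nu (dpoly_alg char0) n (forget s) = denote nu s.
Proof.
rewrite /den /denote /forget big_map; apply: eq_bigr => t _.
rewrite big_map; apply: esym; apply: etrans (scaleMP _ _) _.
apply: (congr1 (fun f : dpoly k n => (nu t.1)%:MP * f)).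
apply: eq_bigr => v _; apply: esym; exact: (@xvar_val k (dpoly_alg char0) n v.1 v.2).
Qed.

Theorem corollary2 (k : fieldType) (nu : nat -> k)
    (k_constructive : constructive_field nu)
    (k_char0 : [pchar k]%R =i pred0) :
  exists D : 2.-tuple nat -> nat,
    recursive D /\
    forall (n p : nat) (F : p.-tuple (presentation n)),
      (forall i : 'I_p, novikov (denote nu (tnth F i))) ->
      (D [tuple n; code_system F] = 1%N <->
       novikov_dependent (fun i : 'I_p => denote nu (tnth F i))).
Proof.
case: k_constructive => nu_onto [eqf [req eqfP]] [addf [radd addfP]] _ [mulf [rmul mulfP]] _.
(* Numbers of 0 and 1 are fixed once and for all, as constants of the programs. *)
have [c0 nu0] := nu_onto 0; have [c1 nu1] := nu_onto 1.
pose addc a b := addf [tuple a; b]; pose mulc a b := mulf [tuple a; b].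
pose eqc a b := eqf [tuple a; b] == 1%N.
have nuD a b : nu (addc a b) = nu a + nu b by exact: addfP.
have nuM a b : nu (mulc a b) = nu a * nu b by exact: mulfP.
have nuE a b : eqc a b <-> nu a = nu b by rewrite -eqfP; split=> /eqP.
have computable_tuple2 (f : 2.-tuple nat -> nat) : recursive f ->
    computable (fun x : nat * nat => f [tuple x.1; x.2]).
  move=> rf; exists (fun c => f [tuple code_head c; code_head (code_tail c)]).
    apply: recursive_comp2 rf _ _; apply: recursive_code_head.
      exact: recursive_nth.
    exact/recursive_code_tail/recursive_nth.
  by move=> [a b]; rewrite /code_head /code_tail /enc /= /enc_pair !CodeSeq.codeK.
have cadd := computable_tuple2 _ radd; have cmul := computable_tuple2 _ rmul.
have ceq : computable (fun x : nat * nat => eqc x.1 x.2).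
  by apply: computable_eq (computable_tuple2 _ req) (computable_const _).
pose cert c := CodeSeq.decode c.
(* A candidate certificate is a list of numbers: the entry 1 announces a
   relation, any other first entry a certificate of independence. *)
pose T (y : nat * (nat * seq rpres)) :=
  if nth 0%N (cert y.1) 0 == 1%N
  then test_dependent c0 c1 addc mulc eqc y.2.1 y.2.2 (dec_pres (nth 0%N (cert y.1) 1))
  else test_independent c0 c1 addc mulc eqc y.2.1 y.2.2
    (dec_sys (nth 0%N (cert y.1) 1)) (dec_seq dec_pair (nth 0%N (cert y.1) 2)).
have cnth i : computable (fun y : nat * (nat * seq rpres) => nth 0%N (cert y.1) i).
  by apply: (computable_comp (computable_decode_nth i)); computable_var.
have cT : computable T.
  apply: computable_if.
  - by apply: computable_eq => //; apply: computable_const.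
  - apply: (computable_test_dependent c0 c1 cadd cmul ceq); try computable_var.
    exact: computable_comp computable_dec_pres (cnth 1%N).
  - apply: (computable_test_independent c0 c1 cadd cmul ceq); try computable_var.
      exact: computable_comp computable_dec_sys (cnth 1%N).
    exact: computable_comp (computable_dec_seq computable_dec_pair) (cnth 2%N).
pose M := dpoly_alg k_char0.
pose dep n F := dependent (P := M) (nthf (P := M) (map (den nu M n) F) (q := size F)).
have depP n F : (exists h, test_dependent c0 c1 addc mulc eqc n F h) <-> dep n F.
  exact: test_dependentP.
have indepP n F :
    (exists J R, test_independent c0 c1 addc mulc eqc n F J R) <-> ~ dep n F.
  exact: test_independentP.
have exT y : exists w, T (w, y).
  case: y => n F; case: (classic (dep n F)) => [/depP [h Th]|/indepP [J [R TR]]].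
    have [c Ec] := dec_pres_onto h; exists (CodeSeq.code [:: 1%N; c]).
    by rewrite /T /cert CodeSeq.codeK /= Ec.
  have [cJ EJ] := dec_seq_onto dec_pres_onto J.
  have [cR ER] := dec_seq_onto dec_pair_onto R.
  exists (CodeSeq.code [:: 0%N; cJ; cR]).
  by rewrite /T /cert CodeSeq.codeK /= /dec_sys EJ ER.
have [w cw Tw] := computable_search cT exT computable_dec_input.
have [g rg gE] : computable (fun c => nth 0%N (cert (w c)) 0).
  exact: computable_comp (computable_decode_nth 0) cw.
exists (fun v => g (code_cons (nth 0%N v 0) (code_cons (nth 0%N v 1) 0))); split.
  apply: (recursive_comp1 rg).
  by do ! [apply: recursive_code_cons | apply: recursive_nth | apply: recursive_const].
move=> n p F _; set c := code_cons _ _.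
have -> : g c = nth 0%N (cert (w c)) 0 by exact: gE.
have dec_c : dec_input c = (n, map (@forget n) F).
  rewrite /dec_input (_ : c = CodeSeq.code [:: n; code_system F]) //.
  by rewrite CodeSeq.codeK /= dec_sysK.
have := Tw c; rewrite dec_c /T /= => Twc.
have depE : dep n (map (@forget n) F) <->
    novikov_dependent (fun i : 'I_p => denote nu (tnth F i)).
  apply: iff_trans (iff_sym (novikov_dependentP k_char0 _)).
  rewrite /dep size_map size_tuple.
  have E : nthf (P := M) (map (den nu M n) (map (@forget n) F)) (q := p) =1
      (fun i : 'I_p => denote nu (tnth F i)).
    move=> i; rewrite /nthf -map_comp (nth_map [::]) ?size_tuple //= denote_forget.
    by rewrite (tnth_nth [::]).
  split; apply: dependent_ext; first exact: E.
  by move=> i; apply: esym; exact: E.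
rewrite -depE; split=> [E|/depP depF].
  by move: Twc; rewrite E eqxx => Th; apply/depP; exists (dec_pres (nth 0%N (cert (w c)) 1)).
apply/eqP; apply: contraPT (depF) => Nk; move: Twc; rewrite (negbTE Nk) => TR.
suff : ~ dep n (map (@forget n) F) by move=> nd; case: nd; apply/depP.
by apply/indepP; do 2!eexists; exact: TR.
Qed.
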